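(* Let $k\ge 1$ and $(\gamma_0,\gamma_1)\in\Gamma$. Let $r_1$ and $r_2$ denote the smallest and largest real roots of $\Delta_k$ in $\mathcal{S}=[\gamma_1,1-\gamma_0]$, respectively, with the possibility of $r_1=r_2$ in case $\Delta_k$ has a unique root in $\mathcal{S}$. Then $\pi^n\Rightarrow\pi$ (weak convergence) as $n\to\infty$, where $$\pi=\begin{cases}\delta_{r_2}, & \text{if } \gamma_1>\gamma_0,\\ \delta_{r_1}, & \text{if } \gamma_1<\gamma_0,\\ \tfrac12\left(\delta_{r_1}+\delta_{r_2}\right), & \text{if } \gamma_1=\gamma_0,\end{cases}$$ and $\delta_x$ denotes the Dirac measure at $x\in\mathbb{R}$.
   Context: Fix an integer $k\ge1$ (independent of $n$) and parameters $(\gamma_0,\gamma_1)\in\Gamma:=\{(\gamma_0,\gamma_1)\in(0,1)^2: 0<\gamma_0+\gamma_1<1\}$. Write $\mathcal{S}=[\gamma_1,1-\gamma_0]$ and let $P_k$ be the polynomial $P_k(x)=\sum_{r=k+1}^{2k}\binom{2k}{r}x^r(1-x)^{2k-r}$. The $2k$-choices model with stubborn agents: there are $n$ agents (complete network), with $N_i^n=\lceil n\gamma_i\rceil$ agents stubbornly holding opinion $i\in\{0,1\}$ forever; each other agent updates at the points of an independent unit-rate Poisson process by sampling $2k$ of the other $n-1$ agents uniformly at random with replacement and adopting the majority opinion among the sampled agents and itself. $X^n(t)$ is the proportion of agents holding opinion $1$ at time $t\ge0$. Equivalently (for $n$ large enough that the state space is nonempty), $X^n=(X^n(t),t\ge0)$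 is the continuous-time birth-death Markov chain on $\mathcal{S}^n=\{N_1^n/n,(N_1^n+1)/n,\ldots,1-N_0^n/n\}$ jumping from $x$ to $x+1/n$ at rate $q^n_+(x)=n\left(1-x-\frac{N_0^n}{n}\right)P_k(b_nx)$ and from $x$ to $x-1/n$ at rate $q^n_-(x)=n\left(x-\frac{N_1^n}{n}\right)P_k(b_n(1-x))$, where $b_n=n/(n-1)$. It is ergodic; $\pi^n$ denotes its unique stationary distribution. The limiting drift is the polynomial $\Delta_k(x)=(1-x-\gamma_0)P_k(x)-(x-\gamma_1)P_k(1-x)$. It has at least one and at most three real roots in $\mathcal{S}$, counted with multiplicity. *)

(* Defs.v *)
From HB Require Import structures.
From mathcomp Require Import all_boot all_order all_algebra.
From mathcomp Require Import all_classical all_reals all_analysis.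

Set Implicit Arguments.
Unset Strict Implicit.
Unset Printing Implicit Defensive.

Import Order.TTheory GRing.Theory Num.Theory.
Import numFieldNormedType.Exports.

Local Open Scope classical_set_scope.
Local Open Scope ring_scope.

Definition in_Gamma (R : realType) (g0 g1 : R) : Prop :=
  [/\ 0 < g0 < 1, 0 < g1 < 1 & 0 < g0 + g1 < 1].

Definition Ppoly (R : realType) (k : nat) : {poly R} :=
  \sum_(k.+1 <= r < (2 * k).+1)
    'C(2 * k, r)%:R *: ('X ^+ r * (1 - 'X) ^+ (2 * k - r)%N).

Definition Delta (R : realType) (k : nat) (g0 g1 : R) : {poly R} :=
  (1 - 'X - g0%:P) * Ppoly R k
    - ('X - g1%:P) * (Ppoly R k \Po (1 - 'X)).

Definition drift_roots (R : realType) (k : nat) (g0 g1 : R) : set R :=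
  [set x | x \in `[g1, 1 - g0] /\ root (Delta k g0 g1) x].

Definition stubborn (R : realType) (g : R) (n : nat) : nat :=
  `|Num.ceil (n%:R * g)|%N.

(* The chain makes sense only when its state space is nonempty, i.e. when
   0 < n and stubborn g0 n + stubborn g1 n <= n; this holds for all large n.
   It has top_state g0 g1 n + 1 states, state i being the opinion-1 proportion
   (stubborn g1 n + i) / n. *)
Definition top_state (R : realType) (g0 g1 : R) (n : nat) : nat :=
  (n - stubborn g0 n - stubborn g1 n)%N.

Definition state (R : realType) (g0 g1 : R) (n : nat)
    (i : 'I_(top_state g0 g1 n).+1) : R :=
  (stubborn g1 n + i)%N%:R / n%:R.

Definition bfactor (R : realType) (n : nat) : R := n%:R / (n%:R - 1).

Definition rate_up (R : realType) (k : nat) (g0 : R) (n : nat) (x : R) : R :=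
  n%:R * (1 - x - (stubborn g0 n)%:R / n%:R) * (Ppoly R k).[bfactor R n * x].

Definition rate_down (R : realType) (k : nat) (g1 : R) (n : nat) (x : R) : R :=
  n%:R * (x - (stubborn g1 n)%:R / n%:R)
    * (Ppoly R k).[bfactor R n * (1 - x)].

(* No boundary case is needed: rate_up vanishes at the largest state and
   rate_down at the smallest one, so that the rows sum to 0. *)
Definition generator (R : realType) (k : nat) (g0 g1 : R) (n : nat) :
    'M[R]_((top_state g0 g1 n).+1) :=
  \matrix_(i, j)
    if j == i.+1 :> nat then rate_up k g0 n (state i)
    else if i == j.+1 :> nat then rate_down k g1 n (state i)
    else if i == j then - (rate_up k g0 n (state i) + rate_down k g1 n (state i))
    else 0.

Definition expmx (R : realType) (m : nat) (A : 'M[R]_m.+1) : 'M[R]_m.+1 :=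
  \matrix_(i, j) limn (series (fun l : nat => (A ^+ l) i j / l`!%:R)).

(* Matrix of transition probabilities P(X^n(t) = state j | X^n(0) = state i). *)
Definition transition (R : realType) (k : nat) (g0 g1 : R) (n : nat) (t : R) :
    'M[R]_((top_state g0 g1 n).+1) :=
  expmx (t *: generator k g0 g1 n).

Definition stationary (R : realType) (k : nat) (g0 g1 : R) (n : nat)
    (mu : probability (measurableTypeR R) R) : Prop :=
  let p := \row_i fine (mu [set @state R g0 g1 n i]) in
  mu (range (@state R g0 g1 n)) = 1%E /\
  forall t : R, 0 <= t -> p *m transition k g0 g1 n t = p.

Definition weak_cvg (R : realType)
    (mu_ : nat -> {measure set (measurableTypeR R) -> \bar R})
    (mu : {measure set (measurableTypeR R) -> \bar R}) : Prop :=
  forall f : R -> R, continuous f -> bounded_fun f ->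
    (\int[mu_ n]_x (f x)%:E)%E @[n --> \oo] --> (\int[mu]_x (f x)%:E)%E.

Definition limit_law (R : realType) (g0 g1 r1 r2 : R) :
    {measure set (measurableTypeR R) -> \bar R} :=
  let d (r : R) : {measure set (measurableTypeR R) -> \bar R} := @dirac _ (measurableTypeR R) r R in
  if g0 < g1 then d r2
  else if g1 < g0 then d r1
  else mscale (2^-1 : R)%:nng (measure_add (d r1) (d r2)).

(* Main.v *)
Require Import Defs.
From mathcomp Require Import all_boot all_order all_algebra.
From mathcomp Require Import all_classical all_reals all_analysis.
From mathcomp Require Import measurable_realfun ring lra zify.

Import Order.TTheory GRing.Theory Num.Theory.
Import numFieldNormedType.Exports.

Local Open Scope classical_set_scope.
Local Open Scope ring_scope.

(** Write [P] for the majority polynomial. The stationary distribution of a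
    birth-death chain is reversible: the weights [W a] of the states [a / n]
    satisfy [W a * up a = W (a + 1) * down (a + 1)]
    ([tridiagonal_balance], [stationary_balanced]). So the limit is decided by the
    jump ratios [up a / down (a + 1)], and three facts about them suffice.

    First, [up a - down (a + 1)] is exactly [n - 1] times the drift at
    [a / (n - 1)], with slightly shifted parameters ([flow_diff]). Hence weights
    grow geometrically where the drift is bounded below by a positive number and
    decay where it is bounded above by a negative one; such regions keep no mass
    ([vanishing_rise], [vanishing_above]).

    Second, the drift changes sign at most once to the right of [1/2] when
    [g0 <= g1] ([Delta_gt0_before]). With [t = x (1 - x)],
    [P x - P (1 - x) = (2 x - 1) * central_sum t] and
    [P x + P (1 - x) = untied t], where [central_sum] increases with [t] and
    [untied] decreases. So on the upper half all mass gathers at the largest root.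

    Third, when two jump ratios at mirror places are multiplied, the values of [P]
    cancel and only the numbers of stubborn agents remain
    ([balanced_reflect_step]). If [g0 < g1], states below one half are
    exponentially lighter than their mirror images ([balanced_reflect_gain]), so
    all the mass sits at the largest root. If [g0 = g1] the weights are exactly
    symmetric ([balanced_sym]), so the mass is shared equally between the largest
    root and its mirror image, the smallest one. The case [g1 < g0] follows by
    exchanging the opinions. *)

(** * The majority polynomial and the drift *)

(** The probability that a binomial variable with parameters [n] and [x] is at
    least [m]. *)
Definition binom_tail (R : realType) (n m : nat) (x : R) : R :=
  \sum_(m <= r < n.+1) 'C(n, r)%:R * (x ^+ r * (1 - x) ^+ (n - r)).

(** One more trial: it carries the count past [m] exactly when it succeeds
    while the count stands at [m]. *)
Lemma binom_tail_rec (R : realType) (n m : nat) (x : R) : (m <= n)%N ->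
  binom_tail R n.+1 m.+1 x =
  binom_tail R n m.+1 x + x * ('C(n, m)%:R * (x ^+ m * (1 - x) ^+ (n - m))).
Proof.
move=> mn; rewrite /binom_tail big_add1 /=.
have -> : \sum_(m <= i < n.+1)
    'C(n.+1, i.+1)%:R * (x ^+ i.+1 * (1 - x) ^+ (n.+1 - i.+1)) =
  (1 - x) * \sum_(m.+1 <= r < n.+1) 'C(n, r)%:R * (x ^+ r * (1 - x) ^+ (n - r))
  + x * \sum_(m <= r < n.+1) 'C(n, r)%:R * (x ^+ r * (1 - x) ^+ (n - r)).
  have -> : (1 - x) * \sum_(m.+1 <= r < n.+1)
        'C(n, r)%:R * (x ^+ r * (1 - x) ^+ (n - r)) =
      \sum_(m <= i < n.+1) 'C(n, i.+1)%:R * (x ^+ i.+1 * (1 - x) ^+ (n - i)).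
    rewrite big_add1 /= big_nat_recr //= bin_small // mul0r addr0 mulr_sumr.
    apply: eq_big_nat => i /andP[_ iltn].
    by rewrite -(subnSK iltn) [(1 - x) ^+ _.+1]exprS; ring.
  rewrite mulr_sumr -big_split /=; apply: eq_big_nat => i _.
  by rewrite binS natrD subSS exprS; ring.
rewrite [X in x * X]big_ltn ?ltnS //; ring.
Qed.

Lemma PpolyE (R : realType) (k : nat) (x : R) :
  (Ppoly R k).[x] = binom_tail R (2 * k) k.+1 x.
Proof.
by rewrite /Ppoly horner_sum; apply: eq_bigr => r _; rewrite !hornerE.
Qed.

Lemma DeltaE (R : realType) (k : nat) (g0 g1 x : R) :
  (Delta k g0 g1).[x] =
  (1 - x - g0) * (Ppoly R k).[x] - (x - g1) * (Ppoly R k).[1 - x].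
Proof. by rewrite /Delta !(hornerE, horner_comp). Qed.

(** Two more trials. This recursion in [k] yields both the difference and the
    sum of [P_k x] and [P_k (1 - x)] in closed form. *)
Lemma Ppoly_rec (R : realType) (k : nat) (x : R) :
  (Ppoly R k.+1).[x] = (Ppoly R k).[x] +
  (x * (1 - x)) ^+ k *
    ('C(2 * k, k)%:R * x ^+ 2 - 'C(2 * k, k.+1)%:R * (x * (1 - x))).
Proof.
case: k => [|k].
  rewrite !PpolyE /binom_tail muln0 [X in _ = X + _]big_geq // muln1 big_nat1.
  by rewrite bin0 binn bin_small // subnn; ring.
rewrite !PpolyE mulnS !add2n binom_tail_rec; last by lia.
rewrite binom_tail_rec; last by lia.
have -> : binom_tail R (2 * k.+1) k.+2 x =
  'C(2 * k.+1, k.+2)%:R * (x ^+ k.+2 * (1 - x) ^+ k) +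
  binom_tail R (2 * k.+1) k.+3 x.
  rewrite /binom_tail big_ltn; last by lia.
  by have -> : (2 * k.+1 - k.+2 = k)%N by lia.
have -> : ((2 * k.+1).+1 - k.+2 = k.+1)%N by lia.
have -> : (2 * k.+1 - k.+2 = k)%N by lia.
by rewrite binS natrD !exprS exprMn; ring.
Qed.

(** The truncated generating series of the central binomial coefficients. *)
Definition central_sum (R : realType) (k : nat) (t : R) : R :=
  \sum_(i < k) 'C(2 * i, i)%:R * t ^+ i.

(** The probability that [2 k] samples do not split evenly, as a function of
    [t = x (1 - x)]. *)
Definition untied (R : realType) (k : nat) (t : R) : R :=
  1 - 'C(2 * k, k)%:R * t ^+ k.

Lemma Ppoly_diff (R : realType) (k : nat) (x : R) :
  (Ppoly R k).[x] - (Ppoly R k).[1 - x] =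
  (2 * x - 1) * central_sum R k (x * (1 - x)).
Proof.
elim: k => [|k IH].
  by rewrite !PpolyE /binom_tail /central_sum !big_geq // big_ord0; ring.
have -> : central_sum R k.+1 (x * (1 - x)) = central_sum R k (x * (1 - x)) +
    'C(2 * k, k)%:R * (x * (1 - x)) ^+ k by rewrite /central_sum big_ord_recr.
rewrite !Ppoly_rec; have -> : (1 - (1 - x)) = x by ring.
move: IH; rewrite [(1 - x) * x]mulrC.
by set T := (x * (1 - x)) ^+ k => /(canRL (subrK _)) ->; ring.
Qed.

Lemma Ppoly_sum (R : realType) (k : nat) (x : R) :
  (Ppoly R k).[x] + (Ppoly R k).[1 - x] = untied R k (x * (1 - x)).
Proof.
elim: k => [|k IH].
  by rewrite !PpolyE /binom_tail /untied !big_geq // bin0; ring.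
rewrite !Ppoly_rec.
have -> : (1 - (1 - x)) = x by ring.
have bE : 'C(2 * k.+1, k.+1) = (2 * ('C(2 * k, k) + 'C(2 * k, k.+1)))%N.
  rewrite mulnS add2n binS -(bin_sub (n := (2 * k).+1) (m := k)); last by lia.
  have -> : ((2 * k).+1 - k = k.+1)%N by lia.
  by rewrite !binS; lia.
move: IH; rewrite /untied bE natrM natrD [(1 - x) * x]mulrC !exprS.
by set T := (x * (1 - x)) ^+ k => /(canRL (addrK _)) ->; ring.
Qed.

(** The drift as the sum of its even and odd parts about [1/2]. The first part
    carries the asymmetry [g1 - g0]; the coefficients [central_sum] and [untied]
    depend on [x] only through [x (1 - x)]. *)
Lemma Delta_split (R : realType) (k : nat) (g0 g1 x : R) :
  (Delta k g0 g1).[x] =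
  (g1 - g0) / 2 * untied R k (x * (1 - x)) +
  (x - 2^-1) * ((1 - g0 - g1) * central_sum R k (x * (1 - x))
                - untied R k (x * (1 - x))).
Proof.
have D := Ppoly_diff R k x; have S := Ppoly_sum R k x.
rewrite -S DeltaE.
have -> : (x - 2^-1) * ((1 - g0 - g1) * central_sum R k (x * (1 - x)) -
    ((Ppoly R k).[x] + (Ppoly R k).[1 - x])) =
  (1 - g0 - g1) / 2 * ((2 * x - 1) * central_sum R k (x * (1 - x)))
  - (x - 2^-1) * ((Ppoly R k).[x] + (Ppoly R k).[1 - x]) by field.
by rewrite -D; field.
Qed.

Lemma Ppoly_ge0 (R : realType) (k : nat) (x : R) :
  0 <= x <= 1 -> 0 <= (Ppoly R k).[x].
Proof.
move=> /andP[x0 x1]; rewrite PpolyE; apply: sumr_ge0 => r _.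
by rewrite !mulr_ge0 // exprn_ge0 // subr_ge0.
Qed.

Lemma Ppoly_gt0 (R : realType) (k : nat) (x : R) : (1 <= k)%N ->
  0 < x <= 1 -> 0 < (Ppoly R k).[x].
Proof.
move=> k1 /andP[x0 x1]; rewrite PpolyE /binom_tail big_nat_recr /=; last by lia.
rewrite ltr_wpDl //.
  apply: sumr_ge0 => r _.
  by rewrite !mulr_ge0 // exprn_ge0 // ?subr_ge0 // ltW.
by rewrite binn subnn expr0 mulr1 mul1r exprn_gt0.
Qed.

Lemma Ppoly_le1 (R : realType) (k : nat) (x : R) :
  0 <= x <= 1 -> (Ppoly R k).[x] <= 1.
Proof.
move=> /andP[x0 x1].
have P'0 : 0 <= (Ppoly R k).[1 - x] by apply: Ppoly_ge0; lra.
have := Ppoly_sum R k x.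
have : 0 <= 'C(2 * k, k)%:R * (x * (1 - x)) ^+ k.
  by rewrite mulr_ge0 // exprn_ge0 // mulr_ge0 // subr_ge0.
by rewrite /untied; lra.
Qed.

(** * Sign of the drift *)

Lemma central_sum_gt0 (R : realType) (k : nat) (t : R) : (1 <= k)%N ->
  0 <= t -> 0 < central_sum R k t.
Proof.
case: k => // k _ t0; rewrite /central_sum big_ord_recl /= ltr_pwDl //.
  by rewrite bin0 mul1r expr0.
by apply: sumr_ge0 => i _; rewrite mulr_ge0 // exprn_ge0.
Qed.

Lemma central_sum_le (R : realType) (k : nat) (s t : R) :
  0 <= s <= t -> central_sum R k s <= central_sum R k t.
Proof.
move=> /andP[s0 st]; apply: ler_sum => i _; apply: ler_wpM2l => //.
by apply: lerXn2r => //; rewrite nnegrE // (le_trans s0).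
Qed.

Lemma untied_lt (R : realType) (k : nat) (s t : R) : (1 <= k)%N ->
  0 <= s < t -> untied R k t < untied R k s.
Proof.
move=> k1 /andP[s0 st]; rewrite /untied ltrD2l ltrN2 ltr_pM2l.
  by rewrite ltrXn2r ?nnegrE // -?lt0n //; lra.
by rewrite ltr0n bin_gt0; lia.
Qed.

Lemma untied_gt0 (R : realType) (k : nat) (x : R) : (1 <= k)%N ->
  0 <= x <= 1 -> 0 < untied R k (x * (1 - x)).
Proof.
move=> k1 x01; rewrite -Ppoly_sum; have [->|x0] := eqVneq x 0.
  by rewrite subr0 ltr_wpDl ?Ppoly_ge0 ?Ppoly_gt0 //; lra.
rewrite ltr_wpDr ?Ppoly_ge0 ?Ppoly_gt0 //; first by lra.
by move: x01; rewrite le0r (negbTE x0).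
Qed.

Lemma hill_lt (R : realType) (x y : R) :
  2^-1 <= x -> x < y -> y * (1 - y) < x * (1 - x).
Proof.
move=> x2 xy; rewrite -subr_gt0.
have -> : x * (1 - x) - y * (1 - y) = (y - x) * (x + y - 1) by ring.
by rewrite mulr_gt0 //; lra.
Qed.

(** To the right of [1/2] the drift changes sign at most once when [g0 <= g1]:
    divided by [(x - 1/2) * untied], the even part decreases because its numerator
    is constant, and the odd part because [central_sum] decreases and [untied]
    increases as [x] moves away from [1/2]. *)
Lemma Delta_gt0_before (R : realType) (k : nat) (g0 g1 x r : R) :
  (1 <= k)%N -> g0 + g1 < 1 -> g0 <= g1 ->
  2^-1 < x -> x < r -> r <= 1 ->
  0 <= (Delta k g0 g1).[r] -> 0 < (Delta k g0 g1).[x].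
Proof.
move=> k1 g01 gle x2 xr r1 Dr.
have t0 : 0 <= r * (1 - r) by rewrite mulr_ge0 //; lra.
have tlt := hill_lt _ _ _ (ltW x2) xr.
have ar0 := central_sum_gt0 _ _ _ k1 t0.
have ale : central_sum R k (r * (1 - r)) <= central_sum R k (x * (1 - x)).
  by apply: central_sum_le; rewrite t0 ltW.
have bx0 : 0 < untied R k (x * (1 - x)) by apply: untied_gt0 => //; lra.
have blt : untied R k (x * (1 - x)) < untied R k (r * (1 - r)).
  by apply: untied_lt; rewrite // t0.
move: Dr; rewrite !Delta_split.
set a := central_sum _ _ _ in ar0 ale *.
set a' := central_sum _ _ _ in ale *.
set b' := untied _ _ _ in bx0 blt *.
set b := untied _ _ _ in blt *.
set Dr := _ + _ => Dr0; set Dx := _ + _.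
have b0 := lt_trans bx0 blt.
(* Cross-multiplied comparison of the two drifts, each divided by its own
   (x - 1/2) * untied. *)
have E : b * Dx * (r - 2^-1) = b' * Dr * (x - 2^-1) +
  ((g1 - g0) / 2 * (b' * b * (r - x)) +
   (x - 2^-1) * (r - 2^-1) * ((1 - g0 - g1) * (a' * b - a * b'))).
  by rewrite /Dx /Dr; field.
have : 0 < b * Dx * (r - 2^-1).
  rewrite E ltr_wpDl ?ltr_wpDl ?mulr_gt0 ?mulr_ge0 //; try lra.
  rewrite subr_gt0; apply: lt_le_trans (_ : a * b <= _).
    by rewrite ltr_pM2l.
  by rewrite ler_pM2r.
by rewrite pmulr_lgt0; [rewrite pmulr_rgt0|lra].
Qed.

(** Past its largest root the drift is negative, also beyond [1 - g0], where
    the up rate is no longer positive. *)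
Lemma Delta_lt0_after (R : realType) (k : nat) (g0 g1 r x : R) :
  (1 <= k)%N -> in_Gamma g0 g1 ->
  drift_roots k g0 g1 r -> ubound (drift_roots k g0 g1) r ->
  r < x <= 1 -> (Delta k g0 g1).[x] < 0.
Proof.
move=> k1 [/andP[g00 g01] /andP[g10 g11] /andP[_ gg]] [rS _] rub /andP[rx x1].
move: rS; rewrite in_itv /= => /andP[g1r r1].
have Dneg y : 1 - g0 <= y <= 1 -> (Delta k g0 g1).[y] <= 0 /\
    (1 - g0 < y -> (Delta k g0 g1).[y] < 0).
  move=> y01; rewrite !DeltaE.
  have P0 : 0 < (Ppoly R k).[y] by apply: Ppoly_gt0 => //; lra.
  have P'0 : 0 <= (Ppoly R k).[1 - y] by apply: Ppoly_ge0; lra.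
  have Q0 : 0 <= (y - g1) * (Ppoly R k).[1 - y] by rewrite mulr_ge0 //; lra.
  split=> [|y0]; [rewrite subr_le0|rewrite subr_lt0].
    by rewrite (le_trans _ Q0) // mulr_le0_ge0 ?(ltW P0) //; lra.
  by rewrite (lt_le_trans _ Q0) // nmulr_rlt0 //; lra.
have [x0|x0] := ltP (1 - g0) x; first by apply: (Dneg x _).2 => //; lra.
rewrite ltNge; apply/negP => Dx.
have D1 : (Delta k g0 g1).[1 - g0] <= 0 by apply: (Dneg _ _).1; lra.
have [|y /andP[xy y1] yroot] := @poly_ivt _ (- Delta k g0 g1) _ _ x0.
  by rewrite !hornerN oppr_le0 oppr_ge0 Dx.
rewrite rootN in yroot.
have : drift_roots k g0 g1 y.
  split; last exact: yroot.
  by rewrite in_itv /=; lra.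
by move/rub; lra.
Qed.

(** Exchanging the two opinions reverses the drift. *)
Lemma Delta_flip (R : realType) (k : nat) (g0 g1 x : R) :
  (Delta k g1 g0).[1 - x] = - (Delta k g0 g1).[x].
Proof. by rewrite !DeltaE (_ : 1 - (1 - x) = x); ring. Qed.

Lemma drift_roots_flip (R : realType) (k : nat) (g0 g1 x : R) :
  drift_roots k g0 g1 x -> drift_roots k g1 g0 (1 - x).
Proof.
move=> [xS /rootP rx]; split; last by apply/rootP; rewrite Delta_flip rx oppr0.
by move: xS; rewrite !in_itv /=; lra.
Qed.

(** A polynomial positive on a compact interval is bounded away from [0]
    there. *)
Lemma horner_itv_gap (R : realType) (p : {poly R}) (a b : R) :
  (forall x, a <= x <= b -> 0 < p.[x]) ->
  exists2 c, 0 < c & forall x, a <= x <= b -> c <= p.[x].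
Proof.
move=> p0; have [ab|ba] := leP a b; last by exists 1 => // x; lra.
have [|c cab cmin] := @EVT_min R (horner p) a b ab.
  by apply: continuous_subspaceT => x; exact: continuous_horner.
exists p.[c]; first by apply: p0; move: cab; rewrite in_itv.
by move=> x xab; apply: cmin; rewrite in_itv.
Qed.

(** * Detailed balance for finitely many agents *)

(** The up rate when [a] of the [n] agents hold opinion 1, [N] of the others
    being stubborn. Exchanging the opinions, [flow R k N1 n (n - a)] is the down
    rate at [a]. *)
Definition flow (R : realType) (k N n a : nat) : R :=
  (n%:R - a%:R - N%:R) * (Ppoly R k).[a%:R / (n%:R - 1)].

(** Probability weights [W] on [0, ..., n], supported by the states that the
    stubborn agents allow, in detailed balance with the rates. The lower bounds on
    [n], [N0] and [N1] keep the rates positive between allowed states. *)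
Definition balanced (R : realType) (k N0 N1 n : nat) (W : nat -> R) : Prop :=
  [/\ [/\ (1 < n)%N, (1 < N0)%N & (1 < N1)%N],
      forall a, 0 <= W a,
      \sum_(a < n.+1) W a = 1,
      forall a, (a <= n)%N -> (a < N1)%N || (n < a + N0)%N -> W a = 0
    & forall a, (a < n)%N ->
        W a * flow R k N0 n a = W a.+1 * flow R k N1 n (n - a.+1)].

Lemma balanced_flip (R : realType) (k N0 N1 n : nat) (W : nat -> R) :
  balanced R k N0 N1 n W -> balanced R k N1 N0 n (fun a => W (n - a)%N).
Proof.
move=> [[n1 N01 N11] W0 Ws Wz Wb]; split=> //.
- rewrite -Ws (reindex_inj rev_ord_inj) /=; apply: eq_bigr => i _.
  by rewrite subSS subKn // -ltnS.
- by move=> a an H; apply: Wz; lia.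
- move=> a an; rewrite [RHS]Wb; last by lia.
  by congr (_ * _); [congr W|congr flow]; lia.
Qed.

Lemma frac_itv (R : realType) (n a : nat) : (1 < n)%N -> (a < n)%N ->
  0 <= (a%:R / (n%:R - 1) : R) <= 1.
Proof.
move=> n1 an; have n1' : 0 < n%:R - 1 :> R by rewrite subr_gt0 ltr1n.
rewrite divr_ge0 ?(ltW n1') //= ler_pdivrMr // mul1r lerBrDr natr1.
by rewrite ler_nat.
Qed.

Lemma flow_gt0 (R : realType) (k N n a : nat) : (1 <= k)%N ->
  (1 < n)%N -> (0 < a < n)%N -> (a + N < n)%N -> 0 < flow R k N n a.
Proof.
move=> k1 n1 /andP[a0 an] aN; apply: mulr_gt0.
  by rewrite -addrA -opprD -natrD subr_gt0 ltr_nat.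
apply: Ppoly_gt0 => //; have /andP[_ ->] := frac_itv R n a n1 an.
by rewrite andbT divr_gt0 ?ltr0n // subr_gt0 ltr1n.
Qed.

Lemma flow_ge0 (R : realType) (k N n a : nat) :
  (1 < n)%N -> (a < n)%N -> (a + N <= n)%N -> 0 <= flow R k N n a.
Proof.
move=> n1 an aN; apply: mulr_ge0; last exact/Ppoly_ge0/frac_itv.
by rewrite -addrA -opprD -natrD subr_ge0 ler_nat.
Qed.

Lemma flow_le (R : realType) (k N n a : nat) :
  (1 < n)%N -> (a < n)%N -> flow R k N n a <= n%:R.
Proof.
move=> n1 an; have F := frac_itv R n a n1 an.
have P0 := Ppoly_ge0 R k _ F; have P1 := Ppoly_le1 R k _ F.
rewrite /flow; apply: le_trans (_ : n%:R * (Ppoly R k).[a%:R / (n%:R - 1)] <= _).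
  apply: ler_wpM2r => //.
  by rewrite -addrA gerDl -opprD oppr_le0 addr_ge0.
by rewrite ler_piMr.
Qed.

Lemma flow_ltN (R : realType) (k N0 N1 n a : nat) (c : R) :
  (1 < n)%N -> (a < n)%N -> 0 <= c -> c * n%:R <= N1%:R - N0%:R ->
  (1 + c) * flow R k N1 n a <= flow R k N0 n a.
Proof.
move=> n1 an c0 cn; rewrite /flow mulrA; apply: ler_wpM2r.
  exact/Ppoly_ge0/frac_itv.
have : 0 <= c * a%:R + c * N1%:R by rewrite addr_ge0 // mulr_ge0.
lra.
Qed.

(** The parameter which makes the rates of the finite system a drift exactly,
    see [flow_diff]; it tends to the stubborn fraction [N / n]. *)
Definition shifted (R : realType) (n N : nat) : R := (N%:R - 1) / (n%:R - 1).

(** The up rate at [a] minus the down rate at [a + 1] is exactly a drift, with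
    the [shifted] stubborn fractions as parameters. *)
Lemma flow_diff (R : realType) (k N0 N1 n a : nat) :
  (1 < n)%N -> (a < n)%N ->
  flow R k N0 n a - flow R k N1 n (n - a.+1) =
  (n%:R - 1) * (Delta k (shifted R n N0) (shifted R n N1)).[a%:R / (n%:R - 1)].
Proof.
move=> n1 an; rewrite DeltaE /flow /shifted natrB //.
have n0 : n%:R - 1 != 0 :> R by rewrite subr_eq0 pnatr_eq1; lia.
rewrite -natr1; set P := (Ppoly R k).[_].
have -> : (n%:R - (a%:R + 1)) / (n%:R - 1) = 1 - a%:R / (n%:R - 1) :> R by field.
by set Q := (Ppoly R k).[_]; field.
Qed.

(** Where the drift with [shifted] parameters is at least [c], each step up multiplies the weight by at
    least [1 + c / 2]. *)
Lemma balanced_rise (R : realType) (k N0 N1 n a : nat) (W : nat -> R) (c : R) :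
  (1 <= k)%N -> balanced R k N0 N1 n W -> (a < n)%N -> 0 <= c ->
  c <= (Delta k (shifted R n N0) (shifted R n N1)).[a%:R / (n%:R - 1)] ->
  (1 + c / 2) * W a <= W a.+1.
Proof.
move=> k1 [[n1 N01 N11] W0 Ws Wz Wb] an c0 cD.
have [aN|aN] := boolP ((a < N1)%N || (n < a + N0)%N).
  by rewrite Wz // ?mulr0 // ltnW.
have d0 : 0 < flow R k N1 n (n - a.+1) by apply: flow_gt0; lia.
rewrite -(ler_pM2r d0) -Wb // mulrAC mulrC; apply: ler_wpM2l => //.
have dn : flow R k N1 n (n - a.+1) <= n%:R by apply: flow_le; lia.
have /(canRL (subrK _)) -> := flow_diff R k N0 N1 n a n1 an.
rewrite mulrDl mul1r addrC lerD2r.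
apply: le_trans (_ : c / 2 * n%:R <= _); first by rewrite ler_wpM2l //; lra.
apply: le_trans (_ : (n%:R - 1) * c <= _); last first.
  by rewrite ler_wpM2l // subr_ge0 ler1n; lia.
have : 2 <= n%:R :> R by rewrite ler_nat.
move=> n2; rewrite -subr_ge0.
have -> : (n%:R - 1) * c - c / 2 * n%:R = c / 2 * (n%:R - 2) by field.
by rewrite mulr_ge0 ?subr_ge0 //; lra.
Qed.

Lemma iterated_growth (R : realType) (q : R) (W : nat -> R) (a m : nat) :
  0 <= q -> (forall j, (j < m)%N -> q * W (a + j)%N <= W (a + j).+1) ->
  q ^+ m * W a <= W (a + m)%N.
Proof.
move=> q0; elim: m => [|m IH] H; first by rewrite expr0 mul1r addn0.
rewrite addnS exprS -mulrA; apply: le_trans (H m (ltnSn m)).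
by apply: ler_wpM2l => //; apply: IH => j jm; apply: H; exact: ltnW.
Qed.

(** Weights at [a] and at its mirror image [n - a]. In the product of two
    mirror jump ratios the values of [P_k] cancel, which leaves a comparison of
    [N0] and [N1] alone. *)
Lemma balanced_reflect_step (R : realType) (k N0 N1 n a : nat) (W : nat -> R)
    (c x : R) :
  (1 <= k)%N -> balanced R k N0 N1 n W -> 0 <= c ->
  c * n%:R <= N1%:R - N0%:R -> (2 * a + 2 <= n)%N ->
  x * W a.+1 <= W (n - a.+1)%N -> (1 + c) * x * W a <= W (n - a)%N.
Proof.
move=> k1 [[n1 N01 N11] W0 Ws Wz Wb] c0 cn an xW.
have N01' : (N0 <= N1)%N.
  by rewrite -(ler_nat R) -subr_ge0; apply: le_trans cn; rewrite mulr_ge0.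
have [aN|aN] := boolP ((a < N1)%N || (n < a + N0)%N).
  by rewrite (Wz a) // ?mulr0 //; lia.
have u1 : 0 < flow R k N0 n a by apply: flow_gt0; lia.
have d2 : 0 < flow R k N1 n a by apply: flow_gt0; lia.
have d1 : 0 <= flow R k N1 n (n - a.+1) by apply: flow_ge0; lia.
have E1 : W a * flow R k N0 n a = W a.+1 * flow R k N1 n (n - a.+1).
  by apply: Wb; lia.
have E2 : W (n - a.+1)%N * flow R k N0 n (n - a.+1) =
    W (n - a)%N * flow R k N1 n a.
  by rewrite Wb; [congr (_ * _); [congr W|congr flow]|]; lia.
have L1 : (1 + c) * flow R k N1 n a <= flow R k N0 n a.
  by apply: flow_ltN => //; lia.
have L2 : flow R k N1 n (n - a.+1) <= flow R k N0 n (n - a.+1).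
  rewrite -[leLHS]mul1r -[1]addr0; apply: flow_ltN => //; first by lia.
  by rewrite mul0r subr_ge0 ler_nat.
have L0 : 0 <= (1 + c) * flow R k N1 n a.
  by rewrite mulr_ge0 ?addr_ge0 // ltW.
rewrite -(ler_pM2r (mulr_gt0 u1 d2)).
have -> : (1 + c) * x * W a * (flow R k N0 n a * flow R k N1 n a) =
  x * W a.+1 * (flow R k N1 n (n - a.+1) * ((1 + c) * flow R k N1 n a)).
  by rewrite -[RHS]mulrA [W a.+1 * _]mulrA -E1; ring.
have -> : W (n - a)%N * (flow R k N0 n a * flow R k N1 n a) =
  W (n - a.+1)%N * (flow R k N0 n (n - a.+1) * flow R k N0 n a).
  by rewrite [RHS]mulrA E2; ring.
apply: le_trans (_ : W (n - a.+1)%N *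
  (flow R k N1 n (n - a.+1) * ((1 + c) * flow R k N1 n a)) <= _).
  by apply: ler_wpM2r => //; apply: mulr_ge0.
by apply: ler_wpM2l => //; apply: ler_pM.
Qed.

(** When opinion 1 has at least as many stubborn agents as opinion 0, a state
    below one half is at most as heavy as its mirror image above. *)
Lemma balanced_reflect (R : realType) (k N0 N1 n a : nat) (W : nat -> R) :
  (1 <= k)%N -> balanced R k N0 N1 n W -> (N0 <= N1)%N -> (2 * a <= n)%N ->
  W a <= W (n - a)%N.
Proof.
move=> k1 bal N01 an.
have := bal; move=> [[n1 N01' N11] W0 Ws Wz Wb].
have cn : 0 * n%:R <= N1%:R - N0%:R :> R by rewrite mul0r subr_ge0 ler_nat.
(* Induction on n - 2 a, outwards from the middle two states at a time. *)
have [j] := ubnP (n - 2 * a)%N; elim: j a an => // j IH a an aj.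
have [a2|a2] := leqP (2 * a + 2) n.
  have := balanced_reflect_step _ _ _ _ _ _ _ 0 1 k1 bal (lexx 0) cn a2.
  by rewrite addr0 !mul1r; apply; apply: IH; lia.
have [->|aE] := eqVneq n (2 * a)%N.
  by have -> : (2 * a - a = a)%N by lia.
have -> : (n - a = a.+1)%N by lia.
have [aN|aN] := boolP ((a < N1)%N || (n < a + N0)%N).
  by rewrite Wz //; lia.
have u1 : 0 < flow R k N0 n a by apply: flow_gt0; lia.
rewrite -(ler_pM2r u1) Wb; last by lia.
apply: ler_wpM2l => //; have -> : (n - a.+1 = a)%N by lia.
rewrite -[leLHS]mul1r -[1]addr0; apply: flow_ltN => //; lia.
Qed.

(** With a linear excess of stubborn agents for opinion 1, the advantage of the
    mirror image grows geometrically with the distance to one half. *)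
Lemma balanced_reflect_gain (R : realType) (k N0 N1 n a m : nat) (W : nat -> R)
    (c : R) :
  (1 <= k)%N -> balanced R k N0 N1 n W -> 0 <= c ->
  c * n%:R <= N1%:R - N0%:R -> (2 * a + 2 * m <= n)%N ->
  (1 + c) ^+ m * W a <= W (n - a)%N.
Proof.
move=> k1 bal c0 cn; elim: m a => [|m IH] a am.
  rewrite expr0 mul1r; apply: (balanced_reflect _ k N0 N1) => //; last by lia.
  by rewrite -(ler_nat R) -subr_ge0; apply: le_trans cn; rewrite mulr_ge0.
rewrite exprS; apply: (balanced_reflect_step _ k N0 N1) => //; first by lia.
by apply: IH; lia.
Qed.

(** The weights transported from [A] along an injection into [B] add up to at
    most the mass of [B]. *)
Lemma sum_transport (R : realType) (n : nat) (W : nat -> R) (A B : pred nat)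
    (h : nat -> nat) :
  (forall a, 0 <= W a) ->
  (forall a, (a <= n)%N -> A a -> (h a <= n)%N && B (h a)) ->
  (forall a b, (a <= n)%N -> (b <= n)%N -> A a -> A b -> h a = h b -> a = b) ->
  \sum_(a < n.+1 | A a) W (h a) <= \sum_(a < n.+1 | B a) W a.
Proof.
move=> W0 hB hinj.
pose f (a : 'I_n.+1) : 'I_n.+1 := inord (h a).
pose A' := [set a : 'I_n.+1 | A a]%SET.
have fE (a : 'I_n.+1) : A a -> f a = h a :> nat.
  move=> Aa; rewrite inordK // ltnS.
  by case/andP: (hB a (ltn_ord a : (a <= n)%N) Aa).
have finj : {in A' &, injective f}.
  move=> a b; rewrite !inE => Aa Ab fab; apply: val_inj => /=.
  apply: hinj; [exact: (ltn_ord a)|exact: (ltn_ord b)|by []|by []|].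
  by rewrite -(fE _ Aa) -(fE _ Ab) fab.
have -> : \sum_(a < n.+1 | A a) W (h a) = \sum_(a in A') W (f a).
  by apply: eq_big => [a|a Aa]; rewrite ?inE ?fE.
rewrite -(big_imset (fun b : 'I_n.+1 => W b) finj).
rewrite [leLHS]big_mkcond [leRHS]big_mkcond; apply: ler_sum => b _.
case: ifPn => [/imsetP[a]|_]; last by case: ifP.
rewrite inE => Aa ->; rewrite fE //.
by case/andP: (hB a (ltn_ord a : (a <= n)%N) Aa) => _ ->.
Qed.

(** * Regions of vanishing mass *)

Lemma stubborn_bounds (R : realType) (g : R) (n : nat) : 0 <= g ->
  n%:R * g <= (stubborn g n)%:R /\ (stubborn g n)%:R < n%:R * g + 1.
Proof.
move=> g0; have ng0 : 0 <= n%:R * g by rewrite mulr_ge0.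
have c0 : 0 <= Num.ceil (n%:R * g) by rewrite ceil_ge0; lra.
rewrite /stubborn natr_absz ger0_norm //; have /andP[c1 c2] := ceil_itv (n%:R * g).
by split=> //; rewrite intrD in c1; lra.
Qed.

Lemma shifted_near (R : realType) (g e : R) : 0 <= g <= 1 -> 0 < e ->
  \forall n \near \oo, `|shifted R n (stubborn g n) - g| <= e.
Proof.
move=> /andP[g0 g1] e0; near=> n.
have n1 : 1 + e^-1 <= n%:R by near: n; exact: nbhs_infty_ger.
have [N0 N1] := stubborn_bounds R g n g0.
have ei : 0 < e^-1 by rewrite invr_gt0.
have n0 : 0 < n%:R - 1 :> R by lra.
have en : 1 <= e * (n%:R - 1).
  by rewrite -[leLHS](mulfV (lt0r_neq0 e0)) ler_pM2l //; lra.
have -> : shifted R n (stubborn g n) - g =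
    ((stubborn g n)%:R - 1 - g * (n%:R - 1)) / (n%:R - 1).
  by rewrite /shifted; field; rewrite gt_eqF.
rewrite normrM normfV (gtr0_norm n0) ler_pdivrMr //.
by apply: le_trans en; rewrite ler_norml; apply/andP; split; lra.
Unshelve. all: by end_near. Qed.

(** The drifts of the finite systems converge to the limiting one, uniformly
    on [[0, 1]]. *)
Lemma Delta_shifted_near (R : realType) (k : nat) (g0 g1 e : R) :
  0 <= g0 <= 1 -> 0 <= g1 <= 1 -> 0 < e ->
  \forall n \near \oo, forall y, 0 <= y <= 1 ->
    `|(Delta k (shifted R n (stubborn g0 n)) (shifted R n (stubborn g1 n))).[y]
      - (Delta k g0 g1).[y]| <= e.
Proof.
move=> g0E g1E e0; have e2 : 0 < e / 2 by lra.
near=> n => y y01; rewrite !DeltaE.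
have s0 : `|shifted R n (stubborn g0 n) - g0| <= e / 2.
  by near: n; exact: shifted_near.
have s1 : `|shifted R n (stubborn g1 n) - g1| <= e / 2.
  by near: n; exact: shifted_near.
have y01' : 0 <= 1 - y <= 1 by lra.
have P0 := Ppoly_ge0 R k y y01; have P1 := Ppoly_le1 R k y y01.
have Q0 := Ppoly_ge0 R k _ y01'; have Q1 := Ppoly_le1 R k _ y01'.
set s := shifted _ _ _ in s0 *; set s' := shifted _ _ _ in s1 *.
have -> : (1 - y - s) * (Ppoly R k).[y] - (y - s') * (Ppoly R k).[1 - y] -
  ((1 - y - g0) * (Ppoly R k).[y] - (y - g1) * (Ppoly R k).[1 - y]) =
  (s' - g1) * (Ppoly R k).[1 - y] - (s - g0) * (Ppoly R k).[y] by ring.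
apply: le_trans (ler_normB _ _) _; rewrite !normrM (ger0_norm P0) (ger0_norm Q0).
have H1 : `|s' - g1| * (Ppoly R k).[1 - y] <= e / 2 * 1 by apply: ler_pM.
have H2 : `|s - g0| * (Ppoly R k).[y] <= e / 2 * 1 by apply: ler_pM.
by lra.
Unshelve. all: by end_near. Qed.

(** The weight of the proportions [a / n] that satisfy [A]. *)
Definition mass (R : realType) (n : nat) (W : nat -> R) (A : pred R) : R :=
  \sum_(a < n.+1 | A (a%:R / n%:R)) W a.

(** [W n] is [balanced] for the system with [n] agents, for all large [n]. *)
Definition balanced_seq (R : realType) (k : nat) (g0 g1 : R)
    (W : nat -> nat -> R) : Prop :=
  \forall n \near \oo, balanced R k (stubborn g0 n) (stubborn g1 n) n (W n).

(** The weight of [A] tends to [0]. *)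
Definition vanishing (R : realType) (W : nat -> nat -> R) (A : pred R) : Prop :=
  forall e, 0 < e -> \forall n \near \oo, mass R n (W n) A <= e.

Lemma vanishingU (R : realType) (k : nat) (g0 g1 : R) (W : nat -> nat -> R)
    (A B C : pred R) :
  balanced_seq R k g0 g1 W ->
  vanishing R W A -> vanishing R W B ->
  (forall x, 0 <= x <= 1 -> C x -> A x || B x) -> vanishing R W C.
Proof.
move=> bal vA vB CAB e e0; near=> n.
have balN : balanced R k (stubborn g0 n) (stubborn g1 n) n (W n) by near: n.
have [[n1 _ _] W0 _ _ _] := balN.
have mA : mass R n (W n) A <= e / 2 by near: n; apply: vA; lra.
have mB : mass R n (W n) B <= e / 2 by near: n; apply: vB; lra.
apply: le_trans (_ : mass R n (W n) A + mass R n (W n) B <= e); last by lra.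
rewrite /mass [leLHS]big_mkcond [X in X + _]big_mkcond [X in _ + X]big_mkcond.
rewrite -big_split /=.
apply: ler_sum => a _.
have a01 : 0 <= (a%:R / n%:R : R) <= 1.
  rewrite divr_ge0 //= ler_pdivrMr ?ltr0n ?mul1r ?ler_nat; last by lia.
  exact: (ltn_ord a).
have := CAB _ a01; case: (C _) => [/(_ isT)|_].
  by case: (A _); case: (B _); rewrite ?addr0 ?add0r ?lerDl.
by rewrite addr_ge0 //; case: ifP.
Unshelve. all: by end_near. Qed.

Lemma vanishing_flip (R : realType) (W : nat -> nat -> R) (A : pred R) :
  vanishing R (fun n a => W n (n - a)%N) A ->
  vanishing R W (fun x => A (1 - x)).
Proof.
move=> vA e e0; near=> n.
have n0 : (0 < n)%N by near: n; exact: nbhs_infty_gt.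
have -> : mass R n (W n) (fun x => A (1 - x)) =
    mass R n (fun a => W n (n - a)%N) A; last by near: n; exact: vA.
rewrite /mass (reindex_inj rev_ord_inj) /=.
apply: eq_big => [a|a _]; last by rewrite subSS.
rewrite subSS natrB ?(ltn_ord a : (a <= n)%N) //; congr A.
by field; rewrite pnatr_eq0; lia.
Unshelve. all: by end_near. Qed.

Lemma balanced_seq_flip (R : realType) (k : nat) (g0 g1 : R)
    (W : nat -> nat -> R) :
  balanced_seq R k g0 g1 W -> balanced_seq R k g1 g0 (fun n a => W n (n - a)%N).
Proof. by apply: filterS => n; exact: balanced_flip. Qed.

(** Exponential smallness from transport: [A] vanishes if for some [q > 1] and
    every fixed [m] its states can, for large [n], be injected into states that are
    [q ^+ m] times as heavy. As the total mass is [1], a single [m] depending only on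
    the tolerance suffices. *)
Lemma vanishing_gain (R : realType) (k : nat) (g0 g1 q : R)
    (W : nat -> nat -> R) (A : pred R) :
  balanced_seq R k g0 g1 W -> 1 < q ->
  (forall m, \forall n \near \oo, exists h : nat -> nat,
    [/\ forall a, (a <= n)%N -> A (a%:R / n%:R) -> (h a <= n)%N,
        forall a b, (a <= n)%N -> (b <= n)%N -> A (a%:R / n%:R) ->
          A (b%:R / n%:R) -> h a = h b -> a = b
      & forall a, (a <= n)%N -> A (a%:R / n%:R) ->
          q ^+ m * W n a <= W n (h a)]) ->
  vanishing R W A.
Proof.
move=> bal q1 gain e e0.
have q0 : 0 < q by lra.
have [m qm] : exists m, q^-1 ^+ m <= e.
  have : `|q^-1| < 1 by rewrite gtr0_norm ?invr_gt0 // invf_lt1.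
  move=> /cvg_expr /cvgr0Pnorm_le /(_ e e0) /filter_ex[m].
  by exists m; rewrite (le_trans (ler_norm _)).
near=> n.
have balN : balanced R k (stubborn g0 n) (stubborn g1 n) n (W n) by near: n.
have [_ W0 Ws _ _] := balN.
have [h [hn hinj hq]] : exists h : nat -> nat,
    [/\ forall a, (a <= n)%N -> A (a%:R / n%:R) -> (h a <= n)%N,
        forall a b, (a <= n)%N -> (b <= n)%N -> A (a%:R / n%:R) ->
          A (b%:R / n%:R) -> h a = h b -> a = b
      & forall a, (a <= n)%N -> A (a%:R / n%:R) ->
          q ^+ m * W n a <= W n (h a)] by near: n; exact: gain.
apply: le_trans qm; rewrite exprVn -[leRHS]mulr1 ler_pdivlMl ?exprn_gt0 //.
rewrite -Ws mulr_sumr.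
apply: le_trans
  (sum_transport R n (W n) (fun a => A (a%:R / n%:R)) xpredT h W0 _ hinj).
  by apply: ler_sum => a Aa; apply: hq => //; exact: (ltn_ord a).
by move=> a an Aa; rewrite hn.
Unshelve. all: by end_near. Qed.

Lemma vanishing_sub (R : realType) (k : nat) (g0 g1 : R) (W : nat -> nat -> R)
    (A C : pred R) :
  balanced_seq R k g0 g1 W -> vanishing R W A ->
  (forall x, 0 <= x <= 1 -> C x -> A x) -> vanishing R W C.
Proof.
move=> bal vA CA; apply: (vanishingU _ _ _ _ _ _ _ _ bal vA vA) => x x01 /CA.
by move=> /(_ x01) ->.
Qed.

(** A drift of at least [c] makes the weights grow geometrically; half of [c]
    covers the error between the finite and the limiting drifts. *)
Lemma near_rise (R : realType) (k : nat) (g0 g1 al be c : R)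
    (W : nat -> nat -> R) :
  (1 <= k)%N -> 0 <= g0 <= 1 -> 0 <= g1 <= 1 -> balanced_seq R k g0 g1 W ->
  0 <= al -> be <= 1 -> 0 < c ->
  (forall x, al <= x <= be -> c <= (Delta k g0 g1).[x]) ->
  \forall n \near \oo, forall a, (a < n)%N ->
    al <= a%:R / (n%:R - 1) <= be -> (1 + c / 2 / 2) * W n a <= W n a.+1.
Proof.
move=> k1 g0E g1E bal al0 be1 c0 Dc; near=> n => a an aE.
have balN : balanced R k (stubborn g0 n) (stubborn g1 n) n (W n) by near: n.
apply: (balanced_rise _ _ _ _ _ _ _ _ k1 balN an); first by lra.
have : forall y, 0 <= y <= 1 ->
    `|(Delta k (shifted R n (stubborn g0 n)) (shifted R n (stubborn g1 n))).[y]
      - (Delta k g0 g1).[y]| <= c / 2.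
  by near: n; apply: Delta_shifted_near => //; lra.
move=> /(_ (a%:R / (n%:R - 1))) H; have := Dc _ aE.
have /H : 0 <= (a%:R / (n%:R - 1) : R) <= 1 by lra.
by rewrite ler_norml => /andP[]; lra.
Unshelve. all: by end_near. Qed.

(** Room for [m] steps up: states with [a / n] below [be'] stay, in terms of
    the proportion among the other agents, below [be] when [n] is large. *)
Lemma frac_shift_itv (R : realType) (n a j m : nat) (al be be' : R) :
  (1 < n)%N -> (j <= m)%N -> 0 <= al -> be <= 1 ->
  m%:R + be <= n%:R * (be - be') -> al <= a%:R / n%:R <= be' ->
  al <= (a + j)%:R / (n%:R - 1) <= be /\ (a + j < n)%N.
Proof.
move=> n1; rewrite -(ler_nat R) => jm al0 be1 nb.
have n0 : 0 < n%:R - 1 :> R by rewrite subr_gt0 ltr1n.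
have n0' : 0 < n%:R :> R by lra.
rewrite ler_pdivlMr // ler_pdivrMr // => /andP[a1 a2].
have jM : (a + j)%:R <= be * (n%:R - 1) by rewrite natrD; lra.
split.
  rewrite ler_pdivlMr // ler_pdivrMr //; apply/andP; split=> //.
  by rewrite natrD; have : 0 <= j%:R :> R by []; lra.
rewrite -(ler_nat R) -natr1 -lerBrDr; apply: le_trans jM _.
by rewrite ler_piMl // ltW.
Qed.

(** An interval of positive drift loses all its mass to its right. *)
Lemma vanishing_rise (R : realType) (k : nat) (g0 g1 al be' be : R)
    (W : nat -> nat -> R) :
  (1 <= k)%N -> 0 <= g0 <= 1 -> 0 <= g1 <= 1 -> balanced_seq R k g0 g1 W ->
  0 <= al -> be' < be -> be <= 1 ->
  (forall x, al <= x <= be -> 0 < (Delta k g0 g1).[x]) ->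
  vanishing R W (fun x => al <= x <= be').
Proof.
move=> k1 g0E g1E bal al0 be'E be1 D0.
have [c c0 cD] := horner_itv_gap _ _ _ _ D0.
have rise := near_rise R k g0 g1 al be c W k1 g0E g1E bal al0 be1 c0 cD.
apply: (vanishing_gain _ _ _ _ (1 + c / 2 / 2) _ _ bal); first by lra.
move=> m; near=> n; exists (addn^~ m).
have n1 : (1 < n)%N by near: n; exact: nbhs_infty_gt.
have riseN : forall a, (a < n)%N ->
    al <= a%:R / (n%:R - 1) <= be -> (1 + c / 2 / 2) * W n a <= W n a.+1.
  by near: n.
have nb : (m%:R + be) / (be - be') <= n%:R by near: n; exact: nbhs_infty_ger.
have /ler_pdivrMr nbE : 0 < be - be' by lra.
rewrite nbE in nb.
have bound a j : al <= a%:R / n%:R <= be' -> (j <= m)%N ->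
    al <= (a + j)%:R / (n%:R - 1) <= be /\ (a + j < n)%N.
  by move=> aE jm; exact: (frac_shift_itv _ _ _ _ _ _ _ _ n1 jm al0 be1 nb aE).
split.
- by move=> a _ aA; apply: ltnW; case: (bound a m aA (leqnn m)).
- by move=> a b _ _ _ _ /addIn.
- move=> a _ aA; apply: iterated_growth; first by lra.
  move=> j jm; have [aj1 aj2] := bound a j aA (ltnW jm).
  exact: riseN.
Unshelve. all: by end_near. Qed.

Lemma vanishing_above (R : realType) (k : nat) (g0 g1 r e : R)
    (W : nat -> nat -> R) :
  (1 <= k)%N -> in_Gamma g0 g1 -> balanced_seq R k g0 g1 W ->
  drift_roots k g0 g1 r -> ubound (drift_roots k g0 g1) r -> 0 < e ->
  vanishing R W (fun x => r + e <= x).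
Proof.
move=> k1 gam bal rr rub e0.
have [g0E g1E _] := gam.
have rE : 0 < r by case: rr; rewrite in_itv /=; lra.
have v : vanishing R W (fun x => 0 <= 1 - x <= 1 - r - e).
  apply: (vanishing_flip _ _ (fun y => 0 <= y <= 1 - r - e)).
  apply: (vanishing_rise _ k g1 g0 _ _ (1 - r - e / 2)); rewrite //; try lra.
    exact: balanced_seq_flip.
  move=> y yE; have -> : y = 1 - (1 - y) by ring.
  rewrite Delta_flip oppr_gt0; apply: (Delta_lt0_after _ _ _ _ r) => //; lra.
by apply: (vanishing_sub _ _ _ _ _ _ _ bal v) => x; lra.
Qed.

Lemma Delta_half (R : realType) (k : nat) (g0 g1 : R) :
  (Delta k g0 g1).[2^-1] = (g1 - g0) * (Ppoly R k).[2^-1].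
Proof. by rewrite DeltaE (_ : 1 - 2^-1 = 2^-1); [ring|field]. Qed.

(** If opinion 1 has the larger share of stubborn agents, no mass remains at a
    positive distance below one half. *)
Lemma vanishing_reflect (R : realType) (k : nat) (g0 g1 eta : R)
    (W : nat -> nat -> R) :
  (1 <= k)%N -> 0 < g0 -> g0 < g1 -> balanced_seq R k g0 g1 W -> 0 < eta ->
  vanishing R W (fun x => x <= 2^-1 - eta).
Proof.
move=> k1 g00 g01 bal eta0.
apply: (vanishing_gain _ _ _ _ (1 + (g1 - g0) / 2) _ _ bal); first by lra.
move=> m; near=> n; exists (subn n).
have balN : balanced R k (stubborn g0 n) (stubborn g1 n) n (W n) by near: n.
split=> [a _ _|a b an bn _ _ |a an]; [exact: leq_subr|lia|].
have n0 : 0 < n%:R :> R by rewrite ltr0n; case: balN => -[]; lia.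
rewrite ler_pdivrMr // => aE; apply: (balanced_reflect_gain _ _ _ _ _ _ _ _ _ k1 balN).
- by lra.
- have [N0 N0'] := stubborn_bounds R g0 n (ltW g00).
  have [N1 N1'] := stubborn_bounds R g1 n (ltW (lt_trans g00 g01)).
  have /ler_pdivrMr H : 0 < g1 - g0 by lra.
  have : 2 / (g1 - g0) <= n%:R by near: n; exact: nbhs_infty_ger.
  by rewrite H; lra.
- have : m%:R / eta <= n%:R by near: n; exact: nbhs_infty_ger.
  by rewrite ler_pdivrMr // -(ler_nat R) natrD !natrM; lra.
Unshelve. all: by end_near. Qed.

(** Concentration at the largest root when [g0 < g1]. *)
Lemma vanishing_biased (R : realType) (k : nat) (g0 g1 r e : R)
    (W : nat -> nat -> R) :
  (1 <= k)%N -> in_Gamma g0 g1 -> g0 < g1 -> balanced_seq R k g0 g1 W ->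
  drift_roots k g0 g1 r -> ubound (drift_roots k g0 g1) r -> 0 < e ->
  vanishing R W (fun x => e <= `|x - r|).
Proof.
move=> k1 gam g01 bal rr rub e0.
have [g0E g1E gE] := gam; have [] := rr; rewrite in_itv /= => rE /rootP Dr.
have D2 : 0 < (Delta k g0 g1).[2^-1].
  by rewrite Delta_half mulr_gt0 ?subr_gt0 // Ppoly_gt0 //; lra.
have r2 : 2^-1 < r.
  rewrite ltNge le_eqVlt; apply/negP => /orP[/eqP rE'|r2].
    by rewrite -rE' Dr ltxx in D2.
  have : (Delta k g0 g1).[2^-1] < 0.
    by apply: (Delta_lt0_after _ _ _ _ r) => //; lra.
  by lra.
have Dpos x : 2^-1 < x -> x < r -> 0 < (Delta k g0 g1).[x].
  by move=> x2 xr; apply: (Delta_gt0_before _ _ _ _ _ r) => //; lra.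
(* The drift is positive at 1/2, hence on a small interval to its left; this
   closes the gap between the reflection bound and the interval ]1/2, r[. *)
have [eta eta0 Deta] : exists2 eta, 0 < eta &
    forall x, `|2^-1 - x| < eta -> 0 < (Delta k g0 g1).[x].
  have : \forall x \near (2^-1 : R), 0 < (Delta k g0 g1).[x].
    by apply: (cvgr_gt _ (@continuous_horner R (Delta k g0 g1) 2^-1)).
  by move=> /nbhs_ballP[eta /= eta0 H]; exists eta => // x; exact: H.
pose et := Num.min (eta / 2) 4^-1.
have et0 : 0 < et by rewrite lt_min; lra.
have et1 : et <= eta / 2 by rewrite ge_min lexx.
have et2 : et <= 4^-1 by rewrite ge_min lexx orbT.
have v1 := vanishing_above R k g0 g1 r e W k1 gam bal rr rub e0.
have v2 : vanishing R W (fun x => x <= 2^-1 - et).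
  by apply: (vanishing_reflect _ k g0 g1) => //; lra.
have v3 : vanishing R W (fun x => 2^-1 - et <= x <= r - e).
  apply: (vanishing_rise _ k g0 g1 _ _ (r - e / 2)); rewrite //; try lra.
  move=> x /andP[x1 x2]; have [x3|x3] := ltP (2^-1) x.
    by apply: Dpos => //; lra.
  by apply: Deta; rewrite ger0_norm; lra.
have v4 : vanishing R W (fun x => (x <= 2^-1 - et) || (r + e <= x)).
  by apply: (vanishingU _ _ _ _ _ _ _ _ bal v2 v1) => x.
apply: (vanishingU _ _ _ _ _ _ _ _ bal v3 v4) => x _.
rewrite ler_normr => /orP[H|H]; apply/orP; [right|]; first by apply/orP; right; lra.
have [x1|x1] := lerP x (2^-1 - et); first by right.
by left; lra.
Qed.

(** * The symmetric case *)

(** In the symmetric case the drift vanishes at [1/2], and no positive lower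
    bound holds on [[1/2, be]]. There the drift of the finite system, which vanishes
    at [1/2] too, is nonnegative exactly, so the weights are still monotone. *)
Lemma near_rise_sym (R : realType) (k : nat) (g r be : R)
    (W : nat -> nat -> R) :
  (1 <= k)%N -> 0 < g < 2^-1 -> balanced_seq R k g g W ->
  (Delta k g g).[r] = 0 -> be < r -> r <= 1 ->
  \forall n \near \oo, forall a, (a < n)%N ->
    (2^-1 : R) <= a%:R / (n%:R - 1) <= be -> W n a <= W n a.+1.
Proof.
move=> k1 gE bal Dr ber r1.
have [be2|be2] := ltP be (2^-1); first by near=> n => a _ aE; lra.
pose b := (be + r) / 2.
have Db : 0 < (Delta k g g).[b].
  by rewrite /b; apply: (Delta_gt0_before _ _ _ _ _ r) => //; lra.
near=> n => a an aE.
have balN : balanced R k (stubborn g n) (stubborn g n) n (W n) by near: n.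
have := balanced_rise _ _ _ _ _ _ _ 0 k1 balN an (lexx 0).
rewrite mul0r addr0 mul1r; apply.
set s := shifted R n (stubborn g n).
have sE : `|s - g| <= (2^-1 - g) / 2.
  by rewrite /s; near: n; apply: shifted_near; lra.
have s2 : s + s < 1 by move: sE; rewrite ler_norml; lra.
have Dsb : 0 <= (Delta k s s).[b].
  have : forall y, 0 <= y <= 1 ->
      `|(Delta k s s).[y] - (Delta k g g).[y]| <= (Delta k g g).[b].
    by rewrite /s; near: n; apply: Delta_shifted_near => //; lra.
  have bE : 0 <= b <= 1 by rewrite /b; lra.
  by move=> /(_ b bE); rewrite ler_norml; lra.
set y := _ / _ in aE *; have [<-|y2] := eqVneq 2^-1 y.
  by rewrite Delta_half subrr mul0r.
have {}y2 : 2^-1 < y by rewrite lt_neqAle y2; case/andP: aE.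
by rewrite ltW // (Delta_gt0_before _ _ _ _ _ b) //; rewrite /b; lra.
Unshelve. all: by end_near. Qed.

(** A window just above [1/2] is shifted, without loss of weight, into an
    interval of positive drift. *)
Lemma vanishing_half (R : realType) (k : nat) (g r eta : R)
    (W : nat -> nat -> R) :
  (1 <= k)%N -> 0 < g < 2^-1 -> balanced_seq R k g g W ->
  (Delta k g g).[r] = 0 -> r <= 1 -> 0 < eta -> 2^-1 + 4 * eta < r ->
  vanishing R W (fun x => 2^-1 <= x <= 2^-1 + eta).
Proof.
move=> k1 gE bal Dr r1 eta0 etar.
have rise := near_rise_sym R k g r (2^-1 + 4 * eta) W k1 gE bal Dr etar r1.
have v : vanishing R W (fun x => 2^-1 + eta <= x <= 2^-1 + 3 * eta).
  apply: (vanishing_rise _ k g g _ _ (2^-1 + 4 * eta)); rewrite //; try lra.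
  by move=> x xE; apply: (Delta_gt0_before _ _ _ _ _ r) => //; lra.
move=> e e0; near=> n.
apply: le_trans (_ : mass R n (W n)
  (fun x => 2^-1 + eta <= x <= 2^-1 + 3 * eta) <= _); last by near: n; exact: v.
have balN : balanced R k (stubborn g n) (stubborn g n) n (W n) by near: n.
have [[n1 _ _] W0 _ _ _] := balN.
have n0' : 0 < n%:R :> R by rewrite ltr0n; lia.
have riseN : forall a, (a < n)%N ->
    (2^-1 : R) <= a%:R / (n%:R - 1) <= 2^-1 + 4 * eta -> W n a <= W n a.+1.
  by near: n.
have nb : (2 + 4 * eta) / eta <= n%:R by near: n; exact: nbhs_infty_ger.
rewrite ler_pdivrMr // in nb.
pose m := stubborn eta n.
have [m1 m2] := stubborn_bounds R eta n (ltW eta0); rewrite -/m in m1 m2.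
have bound a j : (2^-1 : R) <= a%:R / n%:R <= 2^-1 + eta -> (j <= m)%N ->
    (2^-1 : R) <= (a + j)%:R / (n%:R - 1) <= 2^-1 + 4 * eta /\ (a + j < n)%N.
  by move=> aE jm; apply: (frac_shift_itv _ _ _ _ _ _ _ _ n1 jm _ _ _ aE); lra.
have up a : (2^-1 : R) <= a%:R / n%:R <= 2^-1 + eta -> W n a <= W n (a + m)%N.
  move=> aE; rewrite -[leLHS]mul1r -(expr1n R m); apply: iterated_growth => //.
  move=> j jm; rewrite mul1r; have [aj1 aj2] := bound a j aE (ltnW jm).
  exact: riseN.
have tr := sum_transport R n (W n) (fun a => (2^-1 : R) <= a%:R / n%:R <= 2^-1 + eta)
  (fun a => (2^-1 : R) + eta <= a%:R / n%:R <= 2^-1 + 3 * eta) (addn^~ m) W0.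
apply: le_trans (tr _ _); first by apply: ler_sum => a; exact: up.
- move=> a _ aE; have [_ am] := bound a m aE (leqnn m).
  rewrite (ltnW am) /=; move: aE; rewrite !ler_pdivlMr // !ler_pdivrMr // natrD.
  by lra.
- by move=> a b _ _ _ _ /addIn.
Unshelve. all: by end_near. Qed.

(** Symmetric case, upper half: all mass there gathers at the largest root. *)
Lemma vanishing_upper (R : realType) (k : nat) (g r e : R)
    (W : nat -> nat -> R) :
  (1 <= k)%N -> in_Gamma g g -> balanced_seq R k g g W ->
  drift_roots k g g r -> ubound (drift_roots k g g) r -> 0 < e ->
  vanishing R W (fun x => (2^-1 <= x) && (e <= `|x - r|)).
Proof.
move=> k1 gam bal rr rub e0; have [gE _ ggE] := gam.
have [] := rr; rewrite in_itv /= => rE /rootP Dr.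
have v1 := vanishing_above R k g g r e W k1 gam bal rr rub e0.
have r2 : 2^-1 <= r by have := rub _ (drift_roots_flip _ _ _ _ _ rr); lra.
have [rE2|r2'] := eqVneq r 2^-1.
  apply: (vanishing_sub _ _ _ _ _ _ _ bal v1) => x _.
  by rewrite ler_normr; lra.
have {r2'}r2 : 2^-1 < r by rewrite lt_neqAle eq_sym r2'.
pose eta := (r - 2^-1) / 8.
have v2 : vanishing R W (fun x => 2^-1 <= x <= 2^-1 + eta).
  by apply: (vanishing_half _ k g r); rewrite // /eta; lra.
have v3 : vanishing R W (fun x => 2^-1 + eta <= x <= r - e).
  apply: (vanishing_rise _ k g g _ _ (r - e / 2)); rewrite // /eta; try lra.
  by move=> x xE; apply: (Delta_gt0_before _ _ _ _ _ r) => //; lra.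
have v4 : vanishing R W
    (fun x => (2^-1 <= x <= 2^-1 + eta) || (2^-1 + eta <= x <= r - e)).
  by apply: (vanishingU _ _ _ _ _ _ _ _ bal v2 v3) => x.
apply: (vanishingU _ _ _ _ _ _ _ _ bal v1 v4) => x _ /andP[x2].
rewrite ler_normr => /orP[H|H]; first by apply/orP; left; lra.
have [x1|x1] := lerP x (2^-1 + eta); first by rewrite x2 orbT.
by apply/orP; right; apply/orP; right; lra.
Qed.

Lemma vanishing_sym (R : realType) (k : nat) (g r e : R)
    (W : nat -> nat -> R) :
  (1 <= k)%N -> in_Gamma g g -> balanced_seq R k g g W ->
  drift_roots k g g r -> ubound (drift_roots k g g) r -> 0 < e ->
  vanishing R W (fun x => (e <= `|x - r|) && (e <= `|x - (1 - r)|)).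
Proof.
move=> k1 gam bal rr rub e0.
have v1 := vanishing_upper R k g r e W k1 gam bal rr rub e0.
have v2 := vanishing_flip R W _
  (vanishing_upper R k g r e _ k1 gam (balanced_seq_flip _ _ _ _ _ bal) rr rub e0).
apply: (vanishingU _ _ _ _ _ _ _ _ bal v1 v2) => x _ /andP[xr xr'].
have [x2|x2] := lerP 2^-1 x; first by rewrite xr.
apply/orP; right; apply/andP; split; first by lra.
by rewrite -normrN (_ : - (1 - x - r) = x - (1 - r)) //; ring.
Qed.

Lemma balanced_sym (R : realType) (k N n : nat) (W : nat -> R) :
  (1 <= k)%N -> balanced R k N N n W ->
  forall a, (a <= n)%N -> W (n - a)%N = W a.
Proof.
move=> k1 bal.
suff H a : (2 * a <= n)%N -> W (n - a)%N = W a.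
  move=> a an; have [a2|a2] := leqP (2 * a) n; first exact: H.
  by rewrite -(H (n - a)%N); [congr W|]; lia.
move=> a2; apply/eqP; rewrite eq_le; apply/andP; split; last first.
  exact: (balanced_reflect _ _ _ _ _ _ _ k1 bal).
have := balanced_reflect _ _ _ _ _ a _ k1 (balanced_flip _ _ _ _ _ _ bal).
by rewrite (_ : (n - (n - a) = a)%N); [apply|lia].
Qed.

(** * Stationarity and detailed balance *)

Lemma expr_mx_bound (R : realType) (m : nat) (A : 'M[R]_m.+1) (l : nat)
    (i j : 'I_m.+1) :
  `|(A ^+ l) i j| <= (\sum_a \sum_b `|A a b|) ^+ l.
Proof.
set M := \sum_a _; have M0 : 0 <= M by do 2 apply: sumr_ge0 => ? _.
elim: l i j => [|l IH] i j.
  by rewrite !expr0 mxE; case: (i == j); rewrite ?normr1 ?normr0.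
rewrite exprSr mxE exprSr; apply: le_trans (ler_norm_sum _ _ _) _.
apply: le_trans (_ : \sum_c M ^+ l * `|A c j| <= _).
  by apply: ler_sum => c _; rewrite normrM ler_wpM2r.
rewrite -mulr_sumr ler_wpM2l ?exprn_ge0 //; apply: ler_sum => c _.
by rewrite (bigD1 j) //= lerDl sumr_ge0.
Qed.

(** First-order Taylor estimate, entrywise, of [expmx (t *: A)] at [t = 0]. *)
Lemma expmx_first_order (R : realType) (m : nat) (A : 'M[R]_m.+1) :
  exists2 K : R, 0 <= K & forall t i j, 0 <= t <= 1 ->
    `|expmx (t *: A) i j - (1%:M i j + t * A i j)| <= t ^+ 2 * K.
Proof.
set M := \sum_a \sum_b `|A a b|.
have M0 : 0 <= M by do 2 apply: sumr_ge0 => ? _.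
exists (expR M) => [|t i j /andP[t0 t1]]; first exact: expR_ge0.
rewrite /expmx mxE; set u := fun l : nat => _.
have uE l : u l = t ^+ l * ((A ^+ l) i j / l`!%:R).
  by rewrite /u exprZn mxE mulrA.
have ub l : `|u l| <= t ^+ l * exp_coeff M l.
  rewrite uE normrM ger0_norm ?exprn_ge0 // ler_wpM2l ?exprn_ge0 //.
  rewrite normrM normfV (ger0_norm (ler0n _ _)) /exp_coeff /=.
  by rewrite ler_wpM2r ?invr_ge0 ?ler0n // expr_mx_bound.
have cu : cvgn (series u).
  apply: normed_cvg; apply: series_le_cvg (is_cvg_series_exp_coeff M) => l.
  - exact: normr_ge0.
  - exact: exp_coeff_ge0.
  apply: le_trans (ub l) _; rewrite ler_piMl ?exp_coeff_ge0 //.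
  by rewrite exprn_ile1.
have sb n : `|series u n.+2 - (1%:M i j + t * A i j)| <= t ^+ 2 * expR M.
  have -> : series u n.+2 - (1%:M i j + t * A i j) = \sum_(l < n) u l.+2.
    rewrite /series /= big_mkord 2!big_ord_recl /= !uE /bump /=.
    by rewrite !expr0 !expr1 mxE fact0 invr1; ring.
  apply: le_trans (ler_norm_sum _ _ _) _.
  apply: le_trans (_ : \sum_(l < n) t ^+ 2 * exp_coeff M l.+2 <= _).
    apply: ler_sum => l _; apply: le_trans (ub _) _.
    rewrite ler_wpM2r ?exp_coeff_ge0 // -[l.+2]add2n exprD ler_piMr //.
      by rewrite exprn_ge0.
    by rewrite exprn_ile1.
  rewrite -mulr_sumr ler_wpM2l ?exprn_ge0 //.
  have nd : nondecreasing_seq (series (exp_coeff M)).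
    by apply: nondecreasing_series => l _ _; exact: exp_coeff_ge0.
  have := nondecreasing_cvgn_le nd (is_cvg_series_exp_coeff M) n.+2.
  apply: le_trans; rewrite /series /= big_mkord 2!big_ord_recl /=.
  by rewrite addrA lerDr addr_ge0 ?exp_coeff_ge0.
rewrite ler_norml; apply/andP; split.
  rewrite lerBrDr; apply: limr_ge => //; near=> n.
  have n2 : (2 <= n)%N by near: n; exact: nbhs_infty_ge.
  have := sb (n - 2)%N; rewrite (_ : (n - 2).+2 = n); last by lia.
  by rewrite ler_norml lerBrDr => /andP[].
rewrite lerBlDr; apply: limr_le => //; near=> n.
have n2 : (2 <= n)%N by near: n; exact: nbhs_infty_ge.
have := sb (n - 2)%N; rewrite (_ : (n - 2).+2 = n); last by lia.
by rewrite ler_norml lerBlDr => /andP[].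
Unshelve. all: by end_near. Qed.

(** A vector fixed by the semigroup is annihilated by its generator. *)
Lemma expmx_fixed (R : realType) (m : nat) (A : 'M[R]_m.+1) (p : 'rV[R]_m.+1) :
  (forall t, 0 <= t -> p *m expmx (t *: A) = p) -> p *m A = 0.
Proof.
move=> pfix; have [K K0 HK] := expmx_first_order R m A.
apply/rowP => j; rewrite [RHS]mxE; set D := (p *m A) 0 j.
pose S := \sum_i `|p 0 i| * K.
have S0 : 0 <= S by apply: sumr_ge0 => i _; rewrite mulr_ge0.
have DS t : 0 < t <= 1 -> `|D| <= t * S.
  move=> /andP[t0 t1]; rewrite -(ler_pM2l t0).
  have -> : t * (t * S) = \sum_i `|p 0 i| * (t ^+ 2 * K).
    by rewrite /S !mulr_sumr; apply: eq_bigr => i _; ring.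
  have -> : t * `|D| = `|\sum_i p 0 i *
      (expmx (t *: A) i j - (1%:M i j + t * A i j))|.
    rewrite -{1}(gtr0_norm t0) -normrM.
    have -> : \sum_i p 0 i * (expmx (t *: A) i j - (1%:M i j + t * A i j)) =
        (p *m expmx (t *: A)) 0 j - (p *m 1%:M) 0 j - t * D.
      rewrite /D ![in RHS]mxE mulr_sumr -!sumrB.
      by apply: eq_bigr => i _; ring.
    by rewrite pfix ?ltW // mulmx1 subrr sub0r normrN.
  apply: le_trans (ler_norm_sum _ _ _) _; apply: ler_sum => i _.
  by rewrite normrM ler_wpM2l // HK // (ltW t0).
apply/eqP; rewrite -normr_le0; apply/ler_addgt0Pr => e e0; rewrite add0r.
have S1 : 0 < S + e by rewrite ltr_wpDl.
apply: le_trans (DS (e / (S + e)) _) _.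
  by rewrite divr_gt0 //= ler_pdivrMr // mul1r lerDr.
by rewrite mulrAC ler_pdivrMr // ler_pM2l // lerDl ltW.
Qed.

(** A stationary vector of a birth-death generator satisfies detailed balance:
    the stationarity equations are solved one column at a time from the left end. *)
Lemma tridiagonal_balance (R : realType) (m : nat) (A : 'M[R]_m.+1)
    (p : 'rV[R]_m.+1) (u d : nat -> R) :
  (forall i j : 'I_m.+1, A i j =
    if j == i.+1 :> nat then u i else if i == j.+1 :> nat then d i
    else if i == j then - (u i + d i) else 0) ->
  d 0%N = 0 -> p *m A = 0 ->
  forall i, (i < m)%N -> p 0 (inord i) * u i = p 0 (inord i.+1) * d i.+1.
Proof.
move=> AE d0 pA; pose q a := p 0 (inord a).
have col j : (j < m)%N ->
    (if j is j'.+1 then q j' * u j' else 0) + q j.+1 * d j.+1 =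
    q j * (u j + d j).
  move=> jm; have := congr1 (fun v : 'rV[R]_m.+1 => v 0 (inord j)) pA.
  rewrite !mxE => E; apply/eqP; rewrite -subr_eq0; apply/eqP; rewrite -[RHS]E.
  have pick (f : nat -> R) c : (c < m.+1)%N ->
      \sum_(i < m.+1) (if i == c :> nat then f i else 0) = f c.
    by move=> cm; rewrite -big_mkcond /= (big_pred1 (Ordinal cm)).
  have -> : \sum_(i < m.+1) p 0 i * A i (inord j) =
    \sum_(i < m.+1) (if j == i.+1 then q i * u i else 0) +
    \sum_(i < m.+1) (if i == j.+1 :> nat then q i * d i else 0) -
    \sum_(i < m.+1) (if i == j :> nat then q i * (u i + d i) else 0).
    rewrite -big_split -sumrB /=; apply: eq_bigr => i _; rewrite AE.
    rewrite -val_eqE /= inordK; last by lia.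
    rewrite /q inord_val; have [->|ji] := eqVneq j i.+1.
      by rewrite !ifN ?addr0 ?subr0 //; lia.
    have [->|ij] := eqVneq (i : nat) j.+1.
      by rewrite ifN ?add0r ?subr0 //; lia.
    by rewrite !add0r; case: eqP; rewrite ?mulr0 ?oppr0 // mulrN.
  rewrite (pick (fun i => q i * d i)) ?ltnS //.
  rewrite (pick (fun i => q i * (u i + d i))); last by lia.
  congr (_ + _ - _); case: j jm {E} => [|j] jm; first by rewrite big1.
  rewrite -(pick (fun i => q i * u i) j); last by lia.
  by apply: eq_bigr => i _; rewrite eqSS eq_sym.
elim=> [|i IH] im.
  by have := col 0%N im; rewrite d0 addr0 add0r => ->.
have := col _ im; rewrite -/(q i) /= -[q i * _]/(p 0 (inord i) * _) IH; last by lia.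
by rewrite mulrDr addrC => /addIr ->.
Qed.

Lemma measurable_range_ord (R : realType) (m : nat) (x : 'I_m -> R) :
  measurable (range x : set (measurableTypeR R)).
Proof.
have -> : range x = \bigcup_(i in [set: 'I_m]) [set x i].
  apply/seteqP; split=> y /=; first by move=> [i _ <-]; exists i.
  by move=> [i _ ->]; exists i.
apply: fin_bigcup_measurable; first exact: finite_finset.
by move=> i _; exact: measurable_set1.
Qed.

(** Integration against a probability carried by finitely many points. *)
Lemma integral_atoms (R : realType) (mu : probability (measurableTypeR R) R)
    (m : nat) (x : 'I_m -> R) (f : R -> R) :
  injective x -> mu (range x) = 1%E ->
  measurable_fun [set: measurableTypeR R] (f : measurableTypeR R -> R) ->
  (\int[mu]_y (f y)%:E = (\sum_(i < m) fine (mu [set x i]) * f (x i))%:E)%E.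
Proof.
move=> xinj mux mf.
have mpt (y : R) : measurable ([set y] : set (measurableTypeR R)).
  exact: measurable_set1.
have mrange := measurable_range_ord R m x.
have mi i : mu.-integrable setT (fun y => (\1_[set x i] y)%:E).
  exact: integrable_indic.
rewrite (@ae_eq_integral _ _ _ mu setT
  (fun y => \sum_(i < m) ((f (x i))%:E * (\1_[set x i] y)%:E))%E) //.
- rewrite integral_sum //; last by move=> i; exact: integrableZl.
  rewrite -sumEFin; apply: eq_bigr => i _.
  rewrite integralZl // integral_indic // setIT EFinM fineK 1?muleC //.
  exact: fin_num_measure.
- exact/measurable_EFinP.
- by apply: emeasurable_sum => i; apply: measurable_int (integrableZl _ _ (mi i)).
exists (~` range x); split; first exact: measurableC.
  by rewrite [LHS]probability_setC // mux subee.
move=> y /= H [i _ xi]; apply: H => _; rewrite -xi (bigD1 i) //= indicE mem_set //.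
rewrite mule1 big1 ?adde0 // => j ji; rewrite indicE memNset ?mule0 //=.
by move=> /xinj ij; rewrite ij eqxx in ji.
Qed.

Lemma rate_upE (R : realType) (k : nat) (g0 : R) (n a : nat) : (1 < n)%N ->
  rate_up k g0 n (a%:R / n%:R) = flow R k (stubborn g0 n) n a.
Proof.
move=> n1; have n0 : n%:R != 0 :> R by rewrite pnatr_eq0; lia.
have n0' : n%:R - 1 != 0 :> R by rewrite subr_eq0 pnatr_eq1; lia.
rewrite /rate_up /flow /bfactor; congr (_ * _.[_]); first by field.
by field; rewrite n0' n0.
Qed.

Lemma rate_downE (R : realType) (k : nat) (g1 : R) (n a : nat) : (1 < n)%N ->
  (a <= n)%N ->
  rate_down k g1 n (a%:R / n%:R) = flow R k (stubborn g1 n) n (n - a).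
Proof.
move=> n1 an; have n0 : n%:R != 0 :> R by rewrite pnatr_eq0; lia.
have n0' : n%:R - 1 != 0 :> R by rewrite subr_eq0 pnatr_eq1; lia.
rewrite /rate_down /flow /bfactor natrB //; congr (_ * _.[_]); first by field.
by field; rewrite n0' n0.
Qed.

(** The mass of the atom at [a / n]. *)
Definition law_weight (R : realType) (mu : probability (measurableTypeR R) R)
    (n a : nat) : R :=
  fine (mu [set a%:R / n%:R]).

(** A stationary distribution has [balanced] weights and is carried by the
    proportions [a / n]. *)
Lemma stationary_balanced (R : realType) (k : nat) (g0 g1 : R) (n : nat)
    (mu : probability (measurableTypeR R) R) :
  (1 < n)%N -> (1 < stubborn g0 n)%N -> (1 < stubborn g1 n)%N ->
  (stubborn g0 n + stubborn g1 n <= n)%N -> stationary k g0 g1 n mu ->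
  balanced R k (stubborn g0 n) (stubborn g1 n) n (law_weight R mu n) /\
  mu (range (fun a : 'I_n.+1 => a%:R / n%:R)) = 1%E.
Proof.
set N0 := stubborn g0 n; set N1 := stubborn g1 n => n1 N01 N11 Nn [mu1 fixp].
have n0 : n%:R != 0 :> R by rewrite pnatr_eq0; lia.
have TE : top_state g0 g1 n = (n - N0 - N1)%N by [].
have iT (i : 'I_(top_state g0 g1 n).+1) : (i <= n - N0 - N1)%N := ltn_ord i.
have frac_inj (a b : nat) : a%:R / n%:R = b%:R / n%:R :> R -> a = b.
  by move=> /(mulIf (invr_neq0 n0)) /eqP; rewrite eqr_nat => /eqP.
have grid1 : mu (range (fun a : 'I_n.+1 => a%:R / n%:R)) = 1%E.
  apply/eqP; rewrite eq_le probability_le1; last exact: measurable_range_ord.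
  rewrite -mu1; apply: le_measure; rewrite ?inE; try exact: measurable_range_ord.
  move=> y [i _ <-] /=; exists (inord (N1 + i)) => //; rewrite inordK //.
  by have := iT i; lia.
split=> //; pose W := law_weight R mu n.
have Wz a : (a <= n)%N -> (a < N1)%N || (n < a + N0)%N -> W a = 0.
  move=> an aN; rewrite /W /law_weight.
  have : mu [set a%:R / n%:R] = 0.
    apply/eqP; rewrite eq_le measure_ge0 andbT.
    have <- : mu (~` range (@state R g0 g1 n)) = 0.
      rewrite [LHS]probability_setC; last exact: measurable_range_ord.
      by rewrite mu1 subee.
    apply: le_measure; rewrite ?inE; first exact: measurable_set1.
      by apply: measurableC; exact: measurable_range_ord.
    move=> y /= -> [i _]; rewrite /state => /frac_inj ai.
    by move: ai; have := iT i; rewrite -/N1; lia.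
  by move=> ->.
have bal i : (i < n - N0 - N1)%N ->
    W (N1 + i)%N * flow R k N0 n (N1 + i) =
    W (N1 + i).+1 * flow R k N1 n (n - (N1 + i).+1).
  move=> ilt; have := expmx_fixed R _ _ _ fixp.
  move=> /(tridiagonal_balance R _ _ _
    (fun i => rate_up k g0 n ((N1 + i)%N%:R / n%:R))
    (fun i => rate_down k g1 n ((N1 + i)%N%:R / n%:R))).
  move=> /(_ _ _ i); rewrite !mxE /state !inordK ?TE; try lia.
  rewrite rate_upE // addnS => H.
  have /H : forall a b : 'I_(top_state g0 g1 n).+1, generator k g0 g1 n a b =
      if b == a.+1 :> nat then rate_up k g0 n ((N1 + a)%N%:R / n%:R)
      else if a == b.+1 :> nat then rate_down k g1 n ((N1 + a)%N%:R / n%:R)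
      else if a == b then - (rate_up k g0 n ((N1 + a)%N%:R / n%:R)
                             + rate_down k g1 n ((N1 + a)%N%:R / n%:R))
      else 0 by move=> a b; rewrite mxE.
  rewrite addn0 [rate_down _ _ _ (N1%:R / _)]/rate_down subrr mulr0 mul0r.
  move=> /(_ erefl ilt); rewrite rate_downE //; lia.
split=> //.
- by move=> a; apply: fine_ge0; exact: measure_ge0.
- have finj : injective (fun a : 'I_n.+1 => a%:R / n%:R : R).
    by move=> a b /frac_inj; exact: val_inj.
  have := integral_cst mu measurableT (1%:E)%E.
  rewrite mul1e => H; have {H} := etrans H (probability_setT mu).
  have := integral_atoms R mu _ _ (cst 1) finj grid1 (measurable_cst _).
  move=> H1 H2; rewrite -[RHS](EFin_inj (etrans (esym H1) H2)).
  by apply: eq_bigr => i _; rewrite mulr1.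
move=> a an; rewrite -/W; have [aN|aN] := ltnP a N1.
  rewrite Wz ?aN // ?mul0r; last exact: ltnW.
  (* Below N1 both sides are zero, at a + 1 = N1 because the down rate is. *)
  have [aN'|aN'] := ltnP a.+1 N1; first by rewrite Wz ?aN' ?mul0r.
  rewrite /flow natrB // (_ : a.+1 = N1); last by lia.
  by rewrite (_ : _ - _ - _ = 0) ?mul0r ?mulr0 //; ring.
have [aT|aT] := ltnP (a - N1) (n - N0 - N1).
  by have := bal _ aT; rewrite subnKC.
rewrite (Wz a.+1) ?mul0r //; last by apply/orP; right; lia.
have [aN'|aN'] := ltnP n (a + N0); first by rewrite Wz ?mul0r ?aN' ?orbT // ltnW.
have -> : a = (n - N0)%N by lia.
have nN : n%:R - (n - N0)%:R - N0%:R = 0 :> R by rewrite natrB; [ring|lia].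
by rewrite /flow nN mul0r mulr0.
Qed.

Lemma stubborn_large (R : realType) (g0 g1 : R) : in_Gamma g0 g1 ->
  \forall n \near \oo, [/\ (1 < n)%N, (1 < stubborn g0 n)%N,
    (1 < stubborn g1 n)%N & (stubborn g0 n + stubborn g1 n <= n)%N].
Proof.
move=> [/andP[g00 g01] /andP[g10 g11] /andP[_ gg]]; near=> n.
have [N0 N0'] := stubborn_bounds R g0 n (ltW g00).
have [N1 N1'] := stubborn_bounds R g1 n (ltW g10).
have two (g : R) : 0 < g -> 2 / g <= n%:R -> 2 <= n%:R * g.
  by move=> gpos; rewrite (ler_pdivrMr _ _ gpos).
split.
- by near: n; exact: nbhs_infty_gt.
- rewrite -(ler_nat R); apply: le_trans N0; apply: two => //.
  by near: n; exact: nbhs_infty_ger.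
- rewrite -(ler_nat R); apply: le_trans N1; apply: two => //.
  by near: n; exact: nbhs_infty_ger.
- rewrite -(ler_nat R) natrD.
  have : 2 <= n%:R * (1 - g0 - g1).
    by apply: two; [lra|near: n; exact: nbhs_infty_ger].
  by lra.
Unshelve. all: by end_near. Qed.

(** * Weak limits *)

(** The weighted averages of [f] tend to [v] when, up to vanishing mass, the
    values of [f] are close to [v]. *)
Lemma concentration_limit (R : realType) (k : nat) (g0 g1 M v : R)
    (W : nat -> nat -> R) (f : R -> R) :
  balanced_seq R k g0 g1 W -> (forall x, `|f x| <= M) ->
  (forall e, 0 < e -> exists2 A : pred R, vanishing R W A &
    forall x, ~~ A x -> `|f x - v| <= e) ->
  (\sum_(a < n.+1) W n a * f (a%:R / n%:R)) @[n --> \oo] --> v.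
Proof.
move=> bal fM conc; apply/cvgrPdist_le => e e0.
have e20 : 0 < e / 2 by lra.
have [A vA fA] := conc _ e20.
have M0 : 0 <= M by apply: le_trans (fM 0).
have K0 : 0 < M + `|v| + 1 by rewrite ltr_wpDl // addr_ge0.
near=> n.
have balN : balanced R k (stubborn g0 n) (stubborn g1 n) n (W n) by near: n.
have [_ W0 Ws _ _] := balN.
have mA : mass R n (W n) A <= e / 2 / (M + `|v| + 1).
  by near: n; apply: vA; rewrite divr_gt0.
have -> : v - \sum_(a < n.+1) W n a * f (a%:R / n%:R) =
    \sum_(a < n.+1) W n a * (v - f (a%:R / n%:R)).
  rewrite -[X in X - _]mul1r -Ws mulr_suml -sumrB.
  by apply: eq_bigr => a _; rewrite mulrBr.
apply: le_trans (ler_norm_sum _ _ _) _.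
apply: le_trans (_ : \sum_(a < n.+1) (W n a * (e / 2) +
    (if A (a%:R / n%:R) then W n a else 0) * (M + `|v| + 1)) <= _).
  apply: ler_sum => a _; rewrite normrM ger0_norm //.
  case: ifPn => Aa.
    rewrite -mulrDr ler_wpM2l //; apply: le_trans (ler_normB _ _) _.
    by have := fM (a%:R / n%:R); lra.
  by rewrite mul0r addr0 ler_wpM2l // distrC fA.
rewrite big_split /= -!mulr_suml Ws mul1r -big_mkcond /=.
by move: mA; rewrite ler_pdivlMr // /mass; lra.
Unshelve. all: by end_near. Qed.

Lemma continuous_closeP (R : realType) (f : R -> R) (r e : R) :
  continuous f -> 0 < e -> exists2 d, 0 < d &
    forall x, `|x - r| < d -> `|f x - f r| <= e.
Proof.
move=> cf e0.
have : \forall x \near r, `|f r - f x| <= e.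
  by have /cvgrPdist_le := cf r; apply.
move=> /nbhs_ballP[d /= d0 H]; exists d => // x xr.
by rewrite distrC; apply: H; rewrite /ball /= distrC.
Qed.

Lemma cvg_one_point (R : realType) (k : nat) (g0 g1 M r : R)
    (W : nat -> nat -> R) (f : R -> R) :
  balanced_seq R k g0 g1 W -> continuous f -> (forall x, `|f x| <= M) ->
  (forall e, 0 < e -> vanishing R W (fun x => e <= `|x - r|)) ->
  (\sum_(a < n.+1) W n a * f (a%:R / n%:R)) @[n --> \oo] --> f r.
Proof.
move=> bal cf fM van; apply: (concentration_limit _ _ _ _ _ _ _ _ bal fM) => e e0.
have [d d0 fd] := continuous_closeP _ _ r _ cf e0.
exists (fun x => d <= `|x - r|); first exact: van.
by move=> x; rewrite -ltNge; exact: fd.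
Qed.

(** By symmetry [f] may be replaced by its even part about [1/2], which takes
    one value at [r] and [1 - r]; so each of the two points receives half the mass. *)
Lemma cvg_two_points (R : realType) (k : nat) (g M r : R)
    (W : nat -> nat -> R) (f : R -> R) : (1 <= k)%N ->
  balanced_seq R k g g W -> continuous f -> (forall x, `|f x| <= M) ->
  (forall e, 0 < e ->
    vanishing R W (fun x => (e <= `|x - r|) && (e <= `|x - (1 - r)|))) ->
  (\sum_(a < n.+1) W n a * f (a%:R / n%:R)) @[n --> \oo]
    --> 2^-1 * (f (1 - r) + f r).
Proof.
move=> k1 bal cf fM van; pose h x := 2^-1 * (f (1 - x) + f x).
have hM x : `|h x| <= M.
  rewrite /h normrM gtr0_norm ?invr_gt0 //.
  have := ler_normD (f (1 - x)) (f x); have := fM x; have := fM (1 - x); lra.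
have lim : (\sum_(a < n.+1) W n a * h (a%:R / n%:R)) @[n --> \oo] --> h r.
  apply: (concentration_limit _ _ _ _ _ _ _ _ bal hM) => e e0.
  have [d d0 fd] := continuous_closeP _ _ r _ cf e0.
  have [d' d'0 fd'] := continuous_closeP _ _ (1 - r) _ cf e0.
  exists (fun x => (Num.min d d' <= `|x - r|) && (Num.min d d' <= `|x - (1 - r)|)).
    by apply: van; rewrite lt_min d0.
  have close x : `|x - r| < Num.min d d' -> `|h x - h r| <= e.
    rewrite lt_min => /andP[/fd F1 xd'].
    have /fd' F2 : `|(1 - x) - (1 - r)| < d'.
      by rewrite (_ : 1 - x - (1 - r) = - (x - r)) ?normrN //; ring.
    have -> : h x - h r = 2^-1 * ((f (1 - x) - f (1 - r)) + (f x - f r)).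
      by rewrite /h; ring.
    rewrite normrM gtr0_norm ?invr_gt0 //.
    have := ler_normD (f (1 - x) - f (1 - r)) (f x - f r); lra.
  have hflip x : h (1 - x) = h x.
    by rewrite /h (_ : 1 - (1 - x) = x) ?[f x + _]addrC //; ring.
  move=> x; rewrite negb_and -!ltNge => /orP[|H]; first exact: close.
  rewrite -hflip; apply: close.
  by rewrite (_ : 1 - x - r = - (x - (1 - r))) ?normrN //; ring.
apply: cvg_trans lim; apply: near_eq_cvg; near=> n.
have balN : balanced R k (stubborn g n) (stubborn g n) n (W n) by near: n.
have [[n1 _ _] _ _ _ _] := balN.
have fl : \sum_(a < n.+1) W n a * f (1 - a%:R / n%:R) =
    \sum_(a < n.+1) W n a * f (a%:R / n%:R).
  rewrite (reindex_inj rev_ord_inj) /=; apply: eq_bigr => a _.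
  have an : (a <= n)%N := ltn_ord a.
  rewrite subSS (balanced_sym _ _ _ _ _ k1 balN) //; congr (_ * f _).
  by rewrite natrB //; field; rewrite pnatr_eq0; lia.
have -> : \sum_(a < n.+1) W n a * h (a%:R / n%:R) =
  2^-1 * (\sum_(a < n.+1) W n a * f (1 - a%:R / n%:R) +
          \sum_(a < n.+1) W n a * f (a%:R / n%:R)).
  by rewrite -big_split mulr_sumr; apply: eq_bigr => a _; rewrite /h /=; ring.
by rewrite fl; field.
Unshelve. all: by end_near. Qed.

Lemma integral_two_diracs (R : realType) (r1 r2 : R) (f : R -> R) :
  let nu := mscale (2^-1 : R)%:nng
    (measure_add (@dirac _ (measurableTypeR R) r1 R)
                 (@dirac _ (measurableTypeR R) r2 R)) in
  continuous f -> (\int[nu]_x (f x)%:E)%E = (2^-1 * (f r1 + f r2))%:E.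
Proof.
move=> nu cf.
have mf : measurable_fun [set: measurableTypeR R]
    (fun x : measurableTypeR R => (f x)%:E).
  by apply/measurable_EFinP; exact: continuous_measurable_fun.
have pos (h : measurableTypeR R -> \bar R) : measurable_fun setT h ->
    (forall x, 0 <= h x)%E ->
    (\int[nu]_x h x)%E = (2^-1%:E * (h r1 + h r2))%E.
  move=> mh h0; rewrite ge0_integral_mscale // ge0_integral_measure_add //.
  by rewrite !integral_dirac // !diracT !mul1e.
rewrite integralE !pos //; try exact: measurable_funepos;
  try exact: measurable_funeneg.
rewrite !funeposE !funenegE -!EFinN -!EFin_max -!EFinD.
congr _%:E.
have E y : Num.max y 0 - Num.max (- y) 0 = y :> R.
  by rewrite /Num.max; case: ltP => y1; case: ltP => y2; lra.
by rewrite -[in RHS](E (f r1)) -[in RHS](E (f r2)); ring.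
Qed.

Theorem theorem4 (R : realType) (k : nat) (g0 g1 r1 r2 : R)
    (mu_ : nat -> probability (measurableTypeR R) R) :
  (1 <= k)%N ->
  in_Gamma g0 g1 ->
  drift_roots k g0 g1 r1 -> lbound (drift_roots k g0 g1) r1 ->
  drift_roots k g0 g1 r2 -> ubound (drift_roots k g0 g1) r2 ->
  (\forall n \near \oo, stationary k g0 g1 n (mu_ n)) ->
  weak_cvg mu_ (limit_law g0 g1 r1 r2).
Proof.
move=> k1 gam rr1 lb1 rr2 ub2 stat f cf bf.
pose W n := law_weight R (mu_ n) n.
have facts : \forall n \near \oo,
    balanced R k (stubborn g0 n) (stubborn g1 n) n (W n) /\
    mu_ n (range (fun a : 'I_n.+1 => a%:R / n%:R)) = 1%E.
  near=> n.
  have [n1 N01 N11 Nn] : [/\ (1 < n)%N, (1 < stubborn g0 n)%N,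
      (1 < stubborn g1 n)%N & (stubborn g0 n + stubborn g1 n <= n)%N].
    by near: n; exact: stubborn_large.
  by apply: stationary_balanced => //; near: n.
have bal : balanced_seq R k g0 g1 W by apply: filterS facts => n [].
have [M fM] : exists M, forall x, `|f x| <= M.
  have [M [_ HM]] := bf; exists (M + 1) => x.
  by apply: HM => //; rewrite ltrDl.
(* The least root is the largest one after the opinions are exchanged. *)
have flip_ub : ubound (drift_roots k g1 g0) (1 - r1).
  by move=> y /drift_roots_flip /lb1; lra.
suff [L EL lim] : exists2 L : R,
    (\int[limit_law g0 g1 r1 r2]_x (f x)%:E)%E = L%:E &
    (\sum_(a < n.+1) W n a * f (a%:R / n%:R)) @[n --> \oo] --> L.
  rewrite EL; have limE : (\sum_(a < n.+1) W n a * f (a%:R / n%:R))%:E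
      @[n --> \oo] --> L%:E.
    by apply: cvg_EFin lim; exact: nearW.
  apply: cvg_trans limE; apply: near_eq_cvg; near=> n.
  have n0 : (0 < n)%N by near: n; exact: nbhs_infty_gt.
  have [_ grid] : balanced R k (stubborn g0 n) (stubborn g1 n) n (W n) /\
    mu_ n (range (fun a : 'I_n.+1 => a%:R / n%:R)) = 1%E by near: n.
  rewrite (integral_atoms R (mu_ n) _ (fun a : 'I_n.+1 => a%:R / n%:R)) //.
    move=> a b /(mulIf _) /eqP; rewrite eqr_nat => H; apply/val_inj/eqP/H.
    by rewrite invr_eq0 pnatr_eq0; lia.
  exact: continuous_measurable_fun.
have mf : measurable_fun [set: measurableTypeR R]
    (fun x : measurableTypeR R => (f x)%:E).
  by apply/measurable_EFinP; exact: continuous_measurable_fun.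
rewrite /limit_law; have [g01|g10|g01] := ltgtP g0 g1.
- exists (f r2); first by rewrite integral_dirac // diracT mul1e.
  apply: (cvg_one_point _ k g0 g1 M _ W f bal cf fM) => e e0.
  exact: vanishing_biased rr2 ub2 e0.
- exists (f r1); first by rewrite integral_dirac // diracT mul1e.
  apply: (cvg_one_point _ k g0 g1 M _ W f bal cf fM) => e e0.
  have gam' : in_Gamma g1 g0 by case: gam => ? ? ?; split=> //; rewrite addrC.
  have := vanishing_flip R W _ (vanishing_biased _ _ _ _ _ _ _ k1 gam' g10
    (balanced_seq_flip _ _ _ _ _ bal) (drift_roots_flip _ _ _ _ _ rr1) flip_ub e0).
  move=> v; apply: (vanishing_sub _ _ _ _ _ _ _ bal v) => x _.
  by rewrite -normrN (_ : - (x - r1) = 1 - x - (1 - r1)) //; ring.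
- subst g1; have r12 : r1 = 1 - r2.
    have := lb1 _ (drift_roots_flip _ _ _ _ _ rr2).
    by have := ub2 _ (drift_roots_flip _ _ _ _ _ rr1); lra.
  exists (2^-1 * (f (1 - r2) + f r2)).
    by rewrite r12; exact: integral_two_diracs.
  apply: (cvg_two_points _ k g0 M r2 W f k1 bal cf fM) => e e0.
  by apply: (vanishing_sym R k g0 r2 e W).
Unshelve. all: by end_near. Qed.
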